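(* Assume $\lambda(x,x)=1$ for all $x\in\Gamma$. Let $n\ge1$ and $\boldsymbol{\nu}\in\Gamma^n$. There exists a unique family of maps $$\Gamma\!\det{}^0_{\mathcal{A}}:\ \mathsf{GL}^0(\boldsymbol{\nu};\mathcal{A})\to(\mathcal{A}^0)^\times,$$ parameterized by the objects $\mathcal{A}$ of $(\Gamma,\lambda)\text{-}\mathtt{Alg}$, such that (AI) it defines a natural transformation between the functors $\mathsf{GL}^0(\boldsymbol{\nu};-)$ and $((-)^0)^\times$ from $(\Gamma,\lambda)\text{-}\mathtt{Alg}$ to the category $\mathtt{Grp}$ of groups (in particular each $\Gamma\!\det^0_{\mathcal{A}}$ is a group morphism); (AII) for every $\mathcal{A}$ and any invertible $a\in\mathcal{A}^0$, $\Gamma\!\det^0_{\mathcal{A}}\big(\mathrm{diag}(1,\dots,1,a)\big)=a$. Moreover, this natural transformation satisfies $$\Gamma\!\det{}^0_{\mathcal{A}}(X)=\det\nolimits_{\underline{\mathcal{A}}}\big(J_\varsigma(X)\big)$$ for all $X\in\mathsf{GL}^0(\boldsymbol{\nu};\mathcal{A})$ and all $\varsigma\in\mathfrak{S}(\lambda)$.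
   Context: $\mathbb{K}$ is a field of characteristic zero and $\Gamma$ is a finitely generated abelian group. $\lambda:\Gamma\times\Gamma\to\mathbb{K}^\times$ is a commutation factor: biadditive with $\lambda(x,y)\lambda(y,x)=1$. A $(\Gamma,\lambda)$-commutative algebra is an associative unital $\Gamma$-graded $\mathbb{K}$-algebra $\mathcal{A}=\bigoplus_\gamma\mathcal{A}^\gamma$ with $ab=\lambda(\tilde a,\tilde b)ba$ for homogeneous $a,b$ ($\tilde a$ is the degree). $(\Gamma,\lambda)\text{-}\mathtt{Alg}$ is the category of these algebras with degree-preserving unital algebra morphisms. When $\lambda(x,x)=1$ for all $x$ (purely even case), $\mathfrak{S}(\lambda)$ is the set of biadditive maps $\varsigma:\Gamma\times\Gamma\to\mathbb{K}^\times$ with $\lambda(x,y)\varsigma(x,y)\varsigma(y,x)^{-1}=1$ for all $x,y$. For $\varsigma\in\mathfrak{S}(\lambda)$, $\underline{\mathcal{A}}$ is the graded vector space $\mathcal{A}$ with product $a\star b=\varsigma(\tilde a,\tilde b)ab$, a commutative associative algebra; $\underline{\mathcal{A}}^0=\mathcal{A}^0$ as algebras. $\det_{\underline{\mathcal{A}}}$ is the usual determinant over $\underline{\mathcal{A}}$. For $\boldsymbol{\nu}=(\nu_1,\dots,\nu_n)\in\Gamma^n$, a degree-$0$ matrix is an $n\times n$ matrix $X=(X^i_{\ j})$ with $X^i_{\ j}\in\mathcal{A}^{\nu_j-\nu_i}$; $\mathsf{GL}^0(\boldsymbol{\nu};\mathcal{A})$ is the group of invertible degree-$0$ matrices under matrix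 multiplication. An algebra morphism $f$ acts entrywise, which makes $\mathsf{GL}^0(\boldsymbol{\nu};-)$ a functor to groups. $((-)^0)^\times$ sends $\mathcal{A}$ to the group of invertible elements of $\mathcal{A}^0$. On degree-$0$ matrices, $J_\varsigma(X)$ is the matrix over $\underline{\mathcal{A}}$ with entries $\varsigma(\nu_i,\nu_j-\nu_i)^{-1}X^i_{\ j}$. *)

(* Defs.v *)
From HB Require Import structures.
From mathcomp Require Import all_boot all_order all_algebra.

Set Implicit Arguments.
Unset Strict Implicit.
Unset Printing Implicit Defensive.

Import GRing.Theory.

Local Open Scope ring_scope.

Definition finitely_generated (G : zmodType) : Prop :=
  exists s : seq G, forall x : G,
    exists c : 'I_(size s) -> int, x = \sum_(i < size s) s`_i *~ c i.

(* Maps into K^* are encoded as nowhere vanishing maps into K. *)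
Definition biadditive (K : fieldType) (G : zmodType) (f : G -> G -> K) : Prop :=
  [/\ forall x y, f x y != 0,
      forall x y z, f (x + y) z = f x z * f y z
    & forall x y z, f x (y + z) = f x y * f x z].

Definition commutation_factor (K : fieldType) (G : zmodType)
    (lam : G -> G -> K) : Prop :=
  biadditive lam /\ forall x y, lam x y * lam y x = 1.

(* The set of biadditive maps that twist lam to the trivial factor.           *)
Record multiplier (K : fieldType) (G : zmodType) (lam : G -> G -> K) :=
  Multiplier {
    mult_fun :> G -> G -> K;
    mult_biadditive : biadditive mult_fun;
    multP : forall x y, lam x y * mult_fun x y * (mult_fun y x)^-1 = 1
  }.

Section Biadditive.
Variables (K : fieldType) (G : zmodType) (f : G -> G -> K).
Hypothesis fB : biadditive f.

Lemma biadditive_neq0 x y : f x y != 0. Proof. by case: fB. Qed.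
Lemma biadditiveDl x y z : f (x + y) z = f x z * f y z.
Proof. by case: fB. Qed.
Lemma biadditiveDr x y z : f x (y + z) = f x y * f x z.
Proof. by case: fB. Qed.
Lemma biadditive0l x : f 0 x = 1.
Proof.
by apply: (mulfI (biadditive_neq0 0 x)); rewrite -biadditiveDl addr0 mulr1.
Qed.
Lemma biadditive0r x : f x 0 = 1.
Proof.
by apply: (mulfI (biadditive_neq0 x 0)); rewrite -biadditiveDr addr0 mulr1.
Qed.
End Biadditive.

(* MathComp's [algType] is not used for the carrier because it excludes the   *)
(* zero algebra. The grading is internal: [gl_hom g] is the subspace A^g, and *)
(* [gl_span], [gl_direct] say that A is the direct sum of these subspaces.    *)
Record glAlg (K : fieldType) (G : zmodType) (lam : G -> G -> K) := GLAlg {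
  gl_mod : lmodType K;
  gl_one : gl_mod;
  gl_mul : gl_mod -> gl_mod -> gl_mod;
  gl_mulA : associative gl_mul;
  gl_mul1l : left_id gl_one gl_mul;
  gl_mul1r : right_id gl_one gl_mul;
  gl_linl : forall b, linear (gl_mul^~ b);
  gl_linr : forall a, linear (gl_mul a);
  gl_hom : G -> {pred gl_mod};
  gl_submod : forall g, submod_closed (gl_hom g);
  gl_span : forall a, exists (s : seq G) (c : G -> gl_mod),
    (forall g, c g \in gl_hom g) /\ a = \sum_(g <- s) c g;
  gl_direct : forall (s : seq G) (c : G -> gl_mod), uniq s ->
    (forall g, c g \in gl_hom g) -> \sum_(g <- s) c g = 0 ->
    forall g, g \in s -> c g = 0;
  gl_hom1 : gl_one \in gl_hom 0;
  gl_homM : forall g h a b, a \in gl_hom g -> b \in gl_hom h ->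
    gl_mul a b \in gl_hom (g + h);
  gl_comm : forall g h a b, a \in gl_hom g -> b \in gl_hom h ->
    gl_mul a b = lam g h *: gl_mul b a
}.

Definition gl_sort (K : fieldType) (G : zmodType) (lam : G -> G -> K)
  (A : glAlg lam) : Type := gl_mod A.
Coercion gl_sort : glAlg >-> Sortclass.

Section GLAlgTheory.
Variables (K : fieldType) (G : zmodType) (lam : G -> G -> K) (A : glAlg lam).

HB.instance Definition _ := GRing.Lmodule.on (gl_sort A).

Fact gl_mulDl : left_distributive (@gl_mul _ _ _ A) +%R.
Proof. by move=> a b c; have /(_ 1 a b) := gl_linl c; rewrite !scale1r. Qed.
Fact gl_mulDr : right_distributive (@gl_mul _ _ _ A) +%R.
Proof. by move=> a b c; have /(_ 1 b c) := gl_linr a; rewrite !scale1r. Qed.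

HB.instance Definition _ := GRing.Zmodule_isPzRing.Build (gl_sort A)
  (@gl_mulA _ _ _ A) (@gl_mul1l _ _ _ A) (@gl_mul1r _ _ _ A) gl_mulDl gl_mulDr.

Definition hom (g : G) : {pred A} := @gl_hom _ _ _ A g.

Lemma gl_scalerAl (k : K) (a b : A) : k *: (a * b) = (k *: a) * b.
Proof.
have /(_ k a 0) := @gl_linl _ _ _ A b.
by rewrite -[gl_mul 0 b]/((0 : A) * b) mul0r !addr0.
Qed.

Lemma gl_scalerAr (k : K) (a b : A) : k *: (a * b) = a * (k *: b).
Proof.
have /(_ k b 0) := @gl_linr _ _ _ A a.
by rewrite -[gl_mul a 0]/(a * (0 : A)) mulr0 !addr0.
Qed.

Lemma hom0 g : 0 \in hom g. Proof. by have [] := @gl_submod _ _ _ A g. Qed.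
Lemma homZD g (k : K) (a b : A) :
  a \in hom g -> b \in hom g -> k *: a + b \in hom g.
Proof. by move=> ha hb; have [_] := @gl_submod _ _ _ A g; apply. Qed.
Lemma homD g (a b : A) : a \in hom g -> b \in hom g -> a + b \in hom g.
Proof. by move=> ha hb; rewrite -[a]scale1r homZD. Qed.
Lemma homZ g (k : K) (a : A) : a \in hom g -> k *: a \in hom g.
Proof. by move=> ha; rewrite -[_ *: _]addr0 homZD ?hom0. Qed.
Lemma homN g (a : A) : a \in hom g -> - a \in hom g.
Proof. by move=> ha; rewrite -scaleN1r homZ. Qed.
Lemma hom_sum g I (r : seq I) (P : pred I) (F : I -> A) :
  (forall i, P i -> F i \in hom g) -> \sum_(i <- r | P i) F i \in hom g.
Proof.
move=> hF; elim/big_rec: _ => [|i a Pi ha]; first exact: hom0.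
by rewrite homD ?hF.
Qed.
Lemma hom1 : (1 : A) \in hom 0. Proof. exact: gl_hom1. Qed.
Lemma homM g h (a b : A) :
  a \in hom g -> b \in hom h -> a * b \in hom (g + h).
Proof. exact: gl_homM. Qed.
Lemma hom_comm g h (a b : A) :
  a \in hom g -> b \in hom h -> a * b = lam g h *: (b * a).
Proof. exact: gl_comm. Qed.

Lemma hom_ind (P : A -> Prop) :
  P 0 -> (forall a b, P a -> P b -> P (a + b)) ->
  (forall g a, a \in hom g -> P a) -> forall a, P a.
Proof.
move=> P0 PD Ph a; have [s [c [hc ->]]] := @gl_span _ _ _ A a.
by elim/big_ind: _ => // g _; apply: (Ph g); apply: hc.
Qed.

Definition is_dec (a : A) (s : seq (G * A)) : bool :=
  all (fun p => p.2 \in hom p.1) s && (a == \sum_(p <- s) p.2).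

Lemma dec_exists (a : A) : exists s, is_dec a s.
Proof.
have [s [c [hc ->]]] := @gl_span _ _ _ A a.
exists [seq (g, c g : A) | g <- s]; apply/andP; split.
  by apply/allP=> p /mapP[g _ ->]; apply: hc.
by rewrite big_map.
Qed.

(* A chosen decomposition of [a] as a sum of homogeneous elements, each       *)
(* paired with its degree.                                                    *)
Definition dec (a : A) : seq (G * A) := xchoose (dec_exists a).

Lemma decP a : is_dec a (dec a). Proof. exact: xchooseP. Qed.

Lemma is_dec_sum (B : zmodType) (F : G -> A -> B) a s t :
  (forall g, F g 0 = 0) -> (forall g x y, F g (x + y) = F g x + F g y) ->
  is_dec a s -> is_dec a t ->
  \sum_(p <- s) F p.1 p.2 = \sum_(p <- t) F p.1 p.2.
Proof.
move=> F0 FD /andP[/allP hs /eqP as_] /andP[/allP ht /eqP at_].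
pose c (r : seq (G * A)) g := \sum_(p <- r | p.1 == g) p.2.
have Fc r g : F g (c r g) = \sum_(p <- r | p.1 == g) F p.1 p.2.
  rewrite /c (big_morph (F g) (FD g) (F0 g)).
  by apply: eq_bigr => p /eqP->.
pose u := undup (map fst s ++ map fst t).
have split_ r (C : zmodType) (H : G * A -> C) : {subset map fst r <= u} ->
    \sum_(p <- r) H p = \sum_(g <- u) \sum_(p <- r | p.1 == g) H p.
  move=> ru; rewrite (exchange_big_dep predT) //=.
  apply: eq_big_seq => p pr.
  rewrite (eq_bigl (pred1 p.1)) => [|g]; last by rewrite /= eq_sym.
  rewrite -big_filter filter_pred1_uniq ?undup_uniq ?big_seq1 //.
  by apply: ru; apply: map_f.
have su : {subset map fst s <= u}.
  by move=> g; rewrite mem_undup mem_cat => ->.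
have tu : {subset map fst t <= u}.
  by move=> g; rewrite mem_undup mem_cat orbC => ->.
have hc r : {in r, forall p, p.2 \in hom p.1} -> forall g, c r g \in hom g.
  move=> hr g; rewrite /c big_seq_cond; apply: hom_sum => p /andP[pr /eqP <-].
  exact: hr.
have ceq g : g \in u -> c s g = c t g.
  move=> gu; apply/eqP; rewrite -subr_eq0; apply/eqP.
  apply: (@gl_direct _ _ _ A u (fun g => c s g - c t g)) => //.
  - exact: undup_uniq.
  - move=> h; apply: homD; first exact: hc.
    by apply: homN; apply: hc.
  - by rewrite sumrB -!split_ // -as_ -at_ subrr.
rewrite (split_ s) // (split_ t) //; apply: eq_big_seq => g gu.
by rewrite -!Fc ceq.
Qed.

Section Star.
Variable sig : multiplier lam.

(* The bilinear extension of a * b = sig(|a|, |b|) ab. *)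
Definition star (a b : A) : A :=
  \sum_(p <- dec a) \sum_(q <- dec b) sig p.1 q.1 *: (p.2 * q.2).

Lemma starE a b s t : is_dec a s -> is_dec b t ->
  star a b = \sum_(p <- s) \sum_(q <- t) sig p.1 q.1 *: (p.2 * q.2).
Proof.
move=> ds dt; rewrite /star.
rewrite (@is_dec_sum _
  (fun g x => \sum_(q <- dec b) sig g q.1 *: (x * q.2)) a _ s) //; first last.
- exact: decP.
- move=> g x y; rewrite -big_split; apply: eq_bigr => q _.
  by rewrite mulrDl scalerDr.
- by move=> g; rewrite big1 // => q _; rewrite mul0r scaler0.
apply: eq_bigr => p _.
rewrite (@is_dec_sum _ (fun g x => sig p.1 g *: (p.2 * x)) b _ t) //.
- by move=> g; rewrite mulr0 scaler0.
- by move=> g x y; rewrite mulrDr scalerDr.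
- exact: decP.
Qed.

Lemma is_dec1 g a : a \in hom g -> is_dec a [:: (g, a)].
Proof. by move=> ha; rewrite /is_dec /= ha big_seq1 /=. Qed.

Lemma star_hom g h a b :
  a \in hom g -> b \in hom h -> star a b = sig g h *: (a * b).
Proof.
by move=> ha hb; rewrite (starE (is_dec1 ha) (is_dec1 hb)) !big_seq1.
Qed.

Lemma is_decD a b s t : is_dec a s -> is_dec b t -> is_dec (a + b) (s ++ t).
Proof.
move=> /andP[hs /eqP as_] /andP[ht /eqP bt].
by rewrite /is_dec all_cat hs ht big_cat /= as_ bt eqxx.
Qed.

Lemma is_decZ (k : K) a s :
  is_dec a s -> is_dec (k *: a) [seq (p.1, k *: p.2) | p <- s].
Proof.
move=> /andP[/allP hs /eqP as_]; apply/andP; split.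
  by apply/allP=> _ /mapP[p ps ->] /=; apply: homZ; apply: hs.
by rewrite big_map /= as_ scaler_sumr.
Qed.

Lemma starDl : left_distributive star +%R.
Proof.
move=> a b c; rewrite (starE (is_decD (decP a) (decP b)) (decP c)).
by rewrite big_cat.
Qed.

Lemma starDr : right_distributive star +%R.
Proof.
move=> a b c; rewrite (starE (decP a) (is_decD (decP b) (decP c))).
by rewrite -big_split; apply: eq_bigr => p _; rewrite big_cat.
Qed.

Lemma starZl (k : K) a b : star (k *: a) b = k *: star a b.
Proof.
rewrite (starE (is_decZ k (decP a)) (decP b)) big_map /star scaler_sumr.
apply: eq_bigr => p _; rewrite scaler_sumr; apply: eq_bigr => q _ /=.
by rewrite -gl_scalerAl !scalerA mulrC.
Qed.

Lemma star0a b : star 0 b = 0.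
Proof. by apply: (addrI (star 0 b)); rewrite -starDl !addr0. Qed.

Lemma stara0 a : star a 0 = 0.
Proof. by apply: (addrI (star a 0)); rewrite -starDr !addr0. Qed.

Lemma star1a : left_id 1 star.
Proof.
elim/hom_ind => [|a b ha hb|g a ha]; first exact: stara0.
  by rewrite starDr ha hb.
rewrite (star_hom hom1 ha) (biadditive0l (mult_biadditive sig)).
by rewrite scale1r mul1r.
Qed.

Lemma starC : commutative star.
Proof.
elim/hom_ind => [b|a a' ha ha' b|g a ha]; first by rewrite star0a stara0.
  by rewrite starDl starDr ha ha'.
elim/hom_ind => [|b b' hb hb'|h b hb]; first by rewrite star0a stara0.
  by rewrite starDl starDr hb hb'.
rewrite (star_hom ha hb) (star_hom hb ha) (hom_comm ha hb) scalerA.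
congr (_ *: _); have sn := biadditive_neq0 (mult_biadditive sig) h g.
by rewrite mulrC -[LHS](divfK sn) multP mul1r.
Qed.

Lemma starA : associative star.
Proof.
elim/hom_ind => [b c|a a' ha ha' b c|g a ha]; first by rewrite !star0a.
  by rewrite !starDl ha ha'.
elim/hom_ind => [c|b b' hb hb' c|h b hb]; first by rewrite stara0 !star0a stara0.
  by rewrite starDr !starDl starDr hb hb'.
elim/hom_ind => [|c c' hc hc'|k c hc]; first by rewrite !stara0.
  by rewrite !starDr hc hc'.
have sB := mult_biadditive sig.
have hbc := homZ (sig h k) (homM hb hc); have hab := homZ (sig g h) (homM ha hb).
rewrite (star_hom ha hb) (star_hom hb hc) (star_hom ha hbc) (star_hom hab hc).
rewrite -gl_scalerAr -gl_scalerAl !scalerA mulrA.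
rewrite (biadditiveDl sB) (biadditiveDr sB); congr (_ *: _).
by rewrite -mulrA mulrC.
Qed.

End Star.
End GLAlgTheory.

Arguments hom {K G lam} A g : simpl never.
Arguments star {K G lam A} sig a b : simpl never.

(* The commutative algebra obtained from A by replacing its product by the    *)
(* star product; its carrier is the graded vector space A.                    *)
Definition underline (K : fieldType) (G : zmodType) (lam : G -> G -> K)
  (A : glAlg lam) (sig : multiplier lam) : Type := gl_sort A.

Section Underline.
Variables (K : fieldType) (G : zmodType) (lam : G -> G -> K) (A : glAlg lam).
Variable sig : multiplier lam.

HB.instance Definition _ := GRing.Lmodule.on (underline A sig).
HB.instance Definition _ := GRing.Zmodule_isComPzRing.Build (underline A sig)
  (starA sig) (starC sig) (star1a sig) (starDl sig).

Lemma underlineM (a b : underline A sig) : a * b = star sig a b.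
Proof. by []. Qed.

Lemma underline_scalerAl (k : K) (a b : underline A sig) :
  k *: (a * b) = (k *: a) * b.
Proof. by rewrite !underlineM starZl. Qed.
End Underline.

Record glMor (K : fieldType) (G : zmodType) (lam : G -> G -> K)
    (A B : glAlg lam) := GLMor {
  glm_fun :> A -> B;
  glm_linear : linear glm_fun;
  glm_monoid : GRing.monoid_morphism glm_fun;
  glm_hom : forall g a, a \in hom A g -> glm_fun a \in hom B g
}.

Section GLMorInstance.
Variables (K : fieldType) (G : zmodType) (lam : G -> G -> K).
Variables (A B : glAlg lam) (f : glMor A B).
HB.instance Definition _ := GRing.isLinear.Build K A B *:%R f (glm_linear f).
HB.instance Definition _ := GRing.isMonoidMorphism.Build A B f (glm_monoid f).
End GLMorInstance.

(* The group of invertible elements of the submonoid S of the ring R. An      *)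
(* element is stored with its inverse, which it determines ([uval_inj]).      *)
Record unitsIn (R : pzRingType) (S : mulrClosed R) := UnitsIn {
  uval :> R;
  uinv : R;
  unitsIn_subproof :
    [&& uval \in S, uinv \in S, uval * uinv == 1 & uinv * uval == 1]
}.

Section UnitsInGroup.
Variables (R : pzRingType) (S : mulrClosed R).
Implicit Types u v : unitsIn S.

Lemma uval_in u : uval u \in S.
Proof. by have /and4P[] := unitsIn_subproof u. Qed.
Lemma uinv_in u : uinv u \in S.
Proof. by have /and4P[] := unitsIn_subproof u. Qed.
Lemma uvalV u : uval u * uinv u = 1.
Proof. by have /and4P[_ _ /eqP] := unitsIn_subproof u. Qed.
Lemma uinvV u : uinv u * uval u = 1.
Proof. by have /and4P[_ _ _ /eqP] := unitsIn_subproof u. Qed.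

Lemma uval_inj : injective (@uval R S).
Proof.
move=> u v uv; have uvi : uinv u = uinv v.
  by rewrite -[LHS]mulr1 -(uvalV v) -uv mulrA uinvV mul1r.
case: u v uv uvi => [x y p] [x' y' p'] /= xx yy.
by subst x' y'; rewrite (bool_irrelevance p p').
Qed.

Let units_pair u : R * R := (uval u, uinv u).
Let pair_units (p : R * R) : option (unitsIn S) :=
  if @idP [&& p.1 \in S, p.2 \in S, p.1 * p.2 == 1 & p.2 * p.1 == 1]
    is ReflectT h then Some (UnitsIn h) else None.
Fact units_pairK : pcancel units_pair pair_units.
Proof.
move=> u; rewrite /pair_units; case: {-}_ / idP => [h|].
  by congr Some; apply: uval_inj.
by case; apply: unitsIn_subproof.
Qed.
HB.instance Definition _ := Choice.copy (unitsIn S) (pcan_type units_pairK).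

Fact units_one_subproof :
  [&& 1 \in S, 1 \in S, 1 * 1 == 1 :> R & 1 * 1 == 1 :> R].
Proof. by rewrite rpred1 mulr1 eqxx. Qed.
Definition units_one : unitsIn S := UnitsIn units_one_subproof.

Fact units_inv_subproof u :
  [&& uinv u \in S, uval u \in S, uinv u * uval u == 1 & uval u * uinv u == 1].
Proof. by rewrite uval_in uinv_in uvalV uinvV eqxx. Qed.
Definition units_inv u : unitsIn S := UnitsIn (units_inv_subproof u).

Fact units_mul_subproof u v :
  [&& uval u * uval v \in S, uinv v * uinv u \in S,
      (uval u * uval v) * (uinv v * uinv u) == 1 &
      (uinv v * uinv u) * (uval u * uval v) == 1].
Proof.
rewrite !rpredM ?uval_in ?uinv_in //=.
rewrite mulrA -[_ * uval v * _]mulrA uvalV mulr1 uvalV eqxx.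
by rewrite mulrA -[_ * uinv u * _]mulrA uinvV mulr1 uinvV eqxx.
Qed.
Definition units_mul u v : unitsIn S := UnitsIn (units_mul_subproof u v).

Fact units_mulA : associative units_mul.
Proof. by move=> u v w; apply: uval_inj; rewrite /= mulrA. Qed.
Fact units_mul1l : left_id units_one units_mul.
Proof. by move=> u; apply: uval_inj; rewrite /= mul1r. Qed.
Fact units_mul1r : right_id units_one units_mul.
Proof. by move=> u; apply: uval_inj; rewrite /= mulr1. Qed.
Fact units_mulVl : left_inverse units_one units_inv units_mul.
Proof. by move=> u; apply: uval_inj; rewrite /= uinvV. Qed.
Fact units_mulVr : right_inverse units_one units_inv units_mul.
Proof. by move=> u; apply: uval_inj; rewrite /= uvalV. Qed.

HB.instance Definition _ := isGroup.Build (unitsIn S)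
  units_mulA units_mul1l units_mul1r units_mulVl units_mulVr.

Lemma uvalM u v : uval (u * v)%g = uval u * uval v. Proof. by []. Qed.
End UnitsInGroup.

Section UnitsInMap.
Variables (R R' : pzRingType) (S : mulrClosed R) (S' : mulrClosed R').
Variables (f : {rmorphism R -> R'}).
Hypothesis fS : forall a, a \in S -> f a \in S'.

Fact units_map_subproof (u : unitsIn S) :
  [&& f (uval u) \in S', f (uinv u) \in S',
      f (uval u) * f (uinv u) == 1 & f (uinv u) * f (uval u) == 1].
Proof.
by rewrite !fS ?uval_in ?uinv_in // -!rmorphM uvalV uinvV rmorph1 eqxx.
Qed.
Definition units_map (u : unitsIn S) : unitsIn S' :=
  UnitsIn (units_map_subproof u).
End UnitsInMap.

Section DegreeZero.
Variables (K : fieldType) (G : zmodType) (lam : G -> G -> K).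

Definition homZ0 (A : glAlg lam) : {pred A} := hom A 0.
Arguments homZ0 : clear implicits.

Fact homZ0_mulr_closed A : mulr_closed (homZ0 A).
Proof. by split=> [|a b ha hb]; rewrite /homZ0 ?hom1 // -[0]addr0 homM. Qed.
HB.instance Definition _ (A : glAlg lam) :=
  GRing.isMulClosed.Build A (homZ0 A) (homZ0_mulr_closed A).

Definition units0 (A : glAlg lam) : Type := unitsIn (homZ0 A).
HB.instance Definition _ (A : glAlg lam) := Group.on (units0 A).

Definition units0_map (A B : glAlg lam) (f : glMor A B) :
  units0 A -> units0 B :=
  @units_map _ _ (homZ0 A) (homZ0 B) f (@glm_hom _ _ _ _ _ f 0).

Lemma units0_mapM (A B : glAlg lam) (f : glMor A B) :
  {morph units0_map f : a b / (a * b)%g}.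
Proof. by move=> a b; apply: uval_inj; rewrite /= rmorphM. Qed.

Variables (n : nat) (nu : 'I_n -> G).

Definition degree0 (A : glAlg lam) : {pred 'M[A]_n} :=
  fun X => [forall i, forall j, X i j \in hom A (nu j - nu i)].
Arguments degree0 : clear implicits.

Lemma degree0P (A : glAlg lam) (X : 'M[A]_n) :
  reflect (forall i j, X i j \in hom A (nu j - nu i)) (X \in degree0 A).
Proof.
apply: (iffP forallP) => [hX i j|hX i]; first by have /forallP := hX i.
exact/forallP.
Qed.

Fact degree0_mulr_closed A : mulr_closed (degree0 A).
Proof.
split=> [|X Y /degree0P hX /degree0P hY]; apply/degree0P => i j; rewrite mxE.
  by case: eqP => [->|_]; rewrite ?subrr ?hom1 ?hom0.
apply: hom_sum => k _.
have ->: nu j - nu i = (nu k - nu i) + (nu j - nu k) by rewrite [RHS]addrC addrA subrK.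
by apply: homM.
Qed.
HB.instance Definition _ (A : glAlg lam) :=
  GRing.isMulClosed.Build 'M[A]_n (degree0 A) (degree0_mulr_closed A).

Definition GL0 (A : glAlg lam) : Type := unitsIn (degree0 A).
HB.instance Definition _ (A : glAlg lam) := Group.on (GL0 A).

Fact map_mx_degree0 (A B : glAlg lam) (f : glMor A B) (X : 'M[A]_n) :
  X \in degree0 A -> map_mx f X \in degree0 B.
Proof. by move=> /degree0P hX; apply/degree0P => i j; rewrite mxE glm_hom. Qed.

Definition GL0_map (A B : glAlg lam) (f : glMor A B) : GL0 A -> GL0 B :=
  @units_map _ _ (degree0 A) (degree0 B) (map_mx f) (@map_mx_degree0 A B f).

Lemma GL0_mapM (A B : glAlg lam) (f : glMor A B) :
  {morph GL0_map f : X Y / (X * Y)%g}.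
Proof. by move=> X Y; apply: uval_inj; rewrite /= rmorphM. Qed.

Definition diag_last_mx (A : glAlg lam) (a : A) : 'M[A]_n :=
  diag_mx (\row_(i < n) if i.+1 == n then a else 1).

Fact diag_last_degree0 (A : glAlg lam) (a : A) :
  a \in hom A 0 -> diag_last_mx a \in degree0 A.
Proof.
move=> ha; apply/degree0P => i j; rewrite !mxE.
case: (i =P j) => [->|_]; last by rewrite mulr0n hom0.
by rewrite subrr mulr1n; case: ifP => _; rewrite ?hom1.
Qed.

Fact diag_last_mxM (A : glAlg lam) (a b : A) : a * b = 1 ->
  diag_last_mx a * diag_last_mx b = 1.
Proof.
move=> ab; rewrite -[LHS]/(diag_last_mx a *m diag_last_mx b).
apply/matrixP => i j; rewrite mul_diag_mx !mxE.
case: (i =P j) => [->|_]; last by rewrite mulr0n mulr0.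
by rewrite mulr1n; case: ifP => _; rewrite ?ab ?mulr1.
Qed.

Fact diag_last_subproof (A : glAlg lam) (a : units0 A) :
  [&& diag_last_mx (uval a) \in degree0 A, diag_last_mx (uinv a) \in degree0 A,
      diag_last_mx (uval a) * diag_last_mx (uinv a) == 1 &
      diag_last_mx (uinv a) * diag_last_mx (uval a) == 1].
Proof.
rewrite !diag_last_degree0 ?(uval_in a) ?(uinv_in a) //=.
by rewrite !diag_last_mxM ?eqxx ?uvalV ?uinvV.
Qed.

Definition diag_last (A : glAlg lam) (a : units0 A) : GL0 A :=
  UnitsIn (diag_last_subproof a).

Definition natural_group_morphism (D : forall A : glAlg lam, GL0 A -> units0 A)
    : Prop :=
  (forall A : glAlg lam, {morph @D A : X Y / (X * Y)%g})
  /\ (forall (A B : glAlg lam) (f : glMor A B) (X : GL0 A),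
        D B (GL0_map f X) = units0_map f (D A X)).

Definition J (sig : multiplier lam) (A : glAlg lam) (X : 'M[A]_n) :
    'M[underline A sig]_n :=
  \matrix_(i, j) ((sig (nu i) (nu j - nu i))^-1 *: X i j : underline A sig).

End DegreeZero.

Arguments homZ0 {K G lam} A.
Arguments degree0 {K G lam n} nu A.
Arguments GL0 {K G lam n} nu A.
Arguments GL0_map {K G lam n} nu {A B} f.
Arguments diag_last {K G lam n} nu {A} a.
Arguments natural_group_morphism {K G lam n} nu D.
Arguments J {K G lam n} nu sig {A} X.

(* Main.v *)
Require Import Defs.
From HB Require Import structures.
From mathcomp Require Import all_boot all_order all_algebra.
From mathcomp Require Import perm finmap ring monalg.
From Stdlib Require Import Classical ClassicalEpsilon FunctionalExtensionality.

Set Implicit Arguments.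
Unset Strict Implicit.
Unset Printing Implicit Defensive.

Import Order.TTheory GRing.Theory Num.Theory.

Local Open Scope ring_scope.

(* A multiplier exists because Gamma is a direct sum of cyclic groups, and    *)
(* det o J then has the required properties. For uniqueness, let L be the     *)
(* algebra underlying A, with its grading forgotten. The coaction sending a   *)
(* homogeneous a to a tensor deg a embeds A in the twisted group algebra      *)
(* L[Gamma], whose degree-0 matrices form a copy of GL_n(L), functorially in  *)
(* the commutative K-algebra L. A natural morphism on GL_n(L) is determined   *)
(* by its value at the generic matrix over K[z_ij][1/det], hence over the     *)
(* field K(z_ij), where elimination applies and unipotent blocks are killed   *)
(* because they are conjugate to their squares.                               *)

(* vector.hom would otherwise shadow the homogeneous components. *)
Local Notation hom := Defs.hom.

(** * Bases of finitely generated abelian groups, existence of multipliers *)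

(** Existence: [JM] makes [J] multiplicative into matrices over the commutative algebra
    [underline A sig], and [det_J_hom0] puts the determinant in degree 0, where the two products
    agree. The multiplier this requires comes from [multiplier_exists], which keeps a triangular
    half of [lam] on a direct sum of cyclic groups ([exists_basis]).

    Uniqueness: let D satisfy both axioms. Over a commutative K-algebra L, the twisted group algebra
    has as its degree-0 matrices a copy of M_n(L), so D induces on GL_n(L) a morphism natural in L
    ([restr]). Over a field this is the determinant by [det_uniqueS]; hence it is so for the generic
    matrix over K[z_ij][1/det], which sits inside a field, and by specialization for every nonzero L
    ([restr_det]). For L equal to A with the star product, the coaction a -> a e_(deg a) is a graded
    morphism carrying X to the lift of J X ([coaction_lift]), and comparing coefficients at e_0
    gives D X = det (J X) ([unique_gdet]). Since this works with every multiplier, the determinant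
    does not depend on the one chosen. *)

Section Bases.
Variable G : zmodType.

Definition comb k (x : 'I_k -> G) (c : 'rV[int]_k) : G :=
  \sum_(i < k) x i *~ c 0 i.

Definition mx_comb k l (P : 'M[int]_(l, k)) (x : 'I_k -> G) (i : 'I_l) : G :=
  comb x (row i P).

Definition span k (x : 'I_k -> G) (g : G) : Prop := exists c, comb x c = g.

Definition same_span k l (x : 'I_k -> G) (y : 'I_l -> G) : Prop :=
  forall g, span x g <-> span y g.

(** Relations vanish term by term, not coefficient by coefficient: the span is the direct sum of the
    cyclic groups generated by the [x i], finite ones allowed. *)
Definition basis k (x : 'I_k -> G) : Prop :=
  forall c, comb x c = 0 -> forall i, x i *~ c 0 i = 0.

Lemma eq_comb k (x y : 'I_k -> G) : x =1 y -> comb x =1 comb y.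
Proof. by move=> xy c; apply: eq_bigr => i _; rewrite xy. Qed.

Lemma combB k (x : 'I_k -> G) c d : comb x (c - d) = comb x c - comb x d.
Proof. by rewrite -sumrB; apply: eq_bigr => i _; rewrite !mxE mulrzBr. Qed.

Lemma comb_delta k (x : 'I_k -> G) i n : comb x (n *: delta_mx 0 i) = x i *~ n.
Proof.
rewrite /comb (bigD1 i) //= big1 => [|j ji]; rewrite !mxE ?eqxx ?(negPf ji).
  by rewrite mulr1 addr0.
by rewrite mulr0.
Qed.

Lemma comb_mx k l (P : 'M[int]_(l, k)) (x : 'I_k -> G) c :
  comb (mx_comb P x) c = comb x (c *m P).
Proof.
rewrite /comb /mx_comb /comb.
under eq_bigr do rewrite mulrz_suml.
rewrite exchange_big; apply: eq_bigr => j _; rewrite mxE mulrz_sumr.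
by apply: eq_bigr => i _; rewrite mxE -mulrzA mulrC.
Qed.

Lemma same_span_trans k l m (x : 'I_k -> G) (y : 'I_l -> G) (z : 'I_m -> G) :
  same_span x y -> same_span y z -> same_span x z.
Proof. by move=> xy yz g; rewrite xy. Qed.

Lemma same_span_unitmx k (R : 'M[int]_k) (x : 'I_k -> G) :
  R \in unitmx -> same_span x (mx_comb R x).
Proof.
move=> uR g; split=> [] [c <-]; last by exists (c *m R); rewrite comb_mx.
by exists (c *m invmx R); rewrite comb_mx mulmxKV.
Qed.

Lemma dvdz_absz_le (m n : int) : n != 0 -> (m %| n)%Z -> (`|m| <= `|n|)%N.
Proof. by move=> n0; rewrite dvdzE; apply: dvdn_leq; rewrite absz_gt0. Qed.

(* The relation c is d0 times the first row of a unimodular matrix.           *)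
Lemma relation_torsion k (x : 'I_k.+1 -> G) c : comb x c = 0 -> c 0 0 != 0 ->
  exists (y : 'I_k.+1 -> G) e,
    [/\ same_span x y, (0 < e <= `|c 0%R 0%R|)%N & y 0 *+ e = 0].
Proof.
move=> xc c0; have [L uL [R uR [d _ cE]]] := int_Smith_normal_form c.
have {}cE : c = (L 0 0 * d`_0) *: row 0 R.
  rewrite [LHS]cE; apply/rowP=> j; rewrite !mxE (bigD1 0) //= big1 => [|i i0].
    by rewrite !mxE big_ord1 !mxE eqxx mulr1n addr0.
  rewrite mxE big_ord1 !mxE (_ : _ == _ = false) ?mulr0 ?mul0r //.
  by apply: contraNF i0 => /eqP i0; apply/eqP/val_inj.
set e := L 0 0 * d`_0 in cE; exists (mx_comb R x), `|e|%N.
have e0 : e != 0 by apply: contraNneq c0 => e0; rewrite cE e0 !mxE mul0r.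
split; first exact: same_span_unitmx.
  rewrite absz_gt0 e0 /=; apply: dvdz_absz_le => //.
  by rewrite cE !mxE dvdz_mulr.
have ye : mx_comb R x 0 *~ e = 0.
  by rewrite -comb_delta comb_mx -scalemxAl -rowE -cE.
rewrite pmulrn; case: (absz e) (abszE e) => [|n]; first by rewrite mulr0z.
by move=> ->; case: (ger0P e) => _; rewrite ?mulrNz ye ?oppr0.
Qed.

Definition split_off k (x : 'I_k.+1 -> G) : Prop :=
  forall c, comb x c = 0 -> x 0 *~ c 0 0 = 0.

Lemma split_offP k (x : 'I_k.+1 -> G) :
  split_off x \/ exists2 c, comb x c = 0 & x 0 *~ c 0 0 <> 0.
Proof.
apply: NNPP => /not_or_and[ns nc]; apply: ns => c xc.
by apply: NNPP => xc0; apply: nc; exists c.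
Qed.

(** Descent on the exponent [e]. A relation that obstructs splitting can have its first coefficient
    reduced modulo [e] without becoming zero, and [relation_torsion] then gives a first generator
    killed by a smaller positive integer. *)
Lemma torsion_split_off k (x : 'I_k.+1 -> G) e : (0 < e)%N -> x 0 *+ e = 0 ->
  exists2 y : 'I_k.+1 -> G, same_span x y & split_off y.
Proof.
elim/ltn_ind: e x => e IH x e_gt0 xe.
case: (split_offP x) => [xs|[c xc xc0]].
  by exists x.
pose c' := c - (e%:Z * (c 0%R 0%R %/ e)%Z) *: delta_mx 0 0.
have c'0 : c' 0 0 = (c 0%R 0%R %% e)%Z.
  by rewrite !mxE !eqxx mulr1 {1}(divz_eq (c 0 0) e) mulrC addrC addKr.
have e0 : e%:Z != 0 by rewrite -lt0n in e_gt0 *.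
have xc' : comb x c' = 0.
  by rewrite combB xc comb_delta mulrzA -pmulrn xe mul0rz subr0.
have c'0n0 : c' 0 0 != 0.
  apply/eqP=> c0; case: xc0; rewrite (divz_eq (c 0 0) e) -c'0 c0 addr0 mulrC.
  by rewrite mulrzA -pmulrn xe mul0rz.
have [y [e' [xy /andP[e'0 e'c] ye]]] := relation_torsion xc' c'0n0.
have [|z yz zs] := IH e' _ y e'0 ye.
  apply: leq_ltn_trans e'c _; rewrite c'0.
  by rewrite -ltz_nat gez0_abs ?modz_ge0 // ltz_pmod.
by exists z => //; apply: same_span_trans yz.
Qed.

(** An obstructing relation has nonzero first coefficient, so some generating family has a torsion
    first member, where the descent can start. *)
Lemma exists_split_off k (x : 'I_k.+1 -> G) :
  exists2 y : 'I_k.+1 -> G, same_span x y & split_off y.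
Proof.
case: (split_offP x) => [xs|[c xc xc0]].
  by exists x.
have c0 : c 0 0 != 0 by apply/eqP=> c0; case: xc0; rewrite c0.
have [y [e [xy /andP[e0 _] ye]]] := relation_torsion xc c0.
have [z yz zs] := torsion_split_off e0 ye.
by exists z => //; apply: same_span_trans yz.
Qed.

Lemma exists_basis k (x : 'I_k -> G) :
  exists2 y : 'I_k -> G, same_span x y & basis y.
Proof.
elim: k x => [|k IH] x; first by exists x => // c _ [].
have [y xy ys] := exists_split_off x.
have [z yz zb] := IH (fun i => y (lift ord0 i)).
pose w (i : 'I_k.+1) := if unlift ord0 i is Some j then z j else y 0.
have w0 : w 0 = y 0 by rewrite /w unlift_none.
have wS j : w (lift ord0 j) = z j by rewrite /w liftK.
have combS (u : 'I_k.+1 -> G) (c : 'rV_(1 + k)) :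
    comb u c = u 0 *~ c 0 0 + comb (fun i => u (lift ord0 i)) (rsubmx c).
  rewrite /comb big_ord_recl; congr (_ + _); apply: eq_bigr => i _.
  by rewrite mxE; congr (_ *~ c 0 _); apply: val_inj.
have hd_row (a : int) (d : 'rV_k) : (row_mx a%:M d : 'rV_(1 + k)) 0 0 = a.
  have -> : 0 = lshift k 0 :> 'I_(1 + k) by apply: val_inj.
  by rewrite row_mxEl mxE eqxx.
have wtl c : comb (fun i => w (lift ord0 i)) c = comb z c by apply: eq_comb.
exists w.
  apply: same_span_trans xy _ => g; split=> [] [c <-].
    have [d dE] := (yz _).1 (ex_intro _ (rsubmx (c : 'rV_(1 + k))) erefl).
    exists (row_mx (c 0 0)%:M d : 'rV_(1 + k)).
    by rewrite !combS wtl row_mxKr -dE w0 hd_row.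
  have [d dE] := (yz _).2 (ex_intro _ (rsubmx (c : 'rV_(1 + k))) erefl).
  exists (row_mx (c 0 0)%:M d : 'rV_(1 + k)).
  by rewrite !combS wtl row_mxKr dE w0 hd_row.
move=> c; rewrite combS wtl w0 => wc.
(* The tail of the relation is rewritten in the generators [y], where [ys] annihilates the leading
   term. *)
have [d dE] := (yz _).2 (ex_intro _ (rsubmx (c : 'rV_(1 + k))) erefl).
have y0 : y 0 *~ c 0 0 = 0.
  have := ys (row_mx (c 0 0)%:M d : 'rV_(1 + k)).
  rewrite combS row_mxKr dE hd_row; apply.
  exact: wc.
move: wc; rewrite y0 add0r => /zb zc i.
case: (unliftP ord0 i) => [j ->|->]; last by rewrite w0.
rewrite wS -[RHS](zc j) mxE; congr (_ *~ c 0 _); exact: val_inj.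
Qed.
End Bases.

Section BiadditiveTheory.
Variables (K : fieldType) (G : zmodType) (f : G -> G -> K).
Hypothesis fB : biadditive f.

Lemma biadditiveNl (x y : G) : f (- x) y = (f x y)^-1.
Proof.
apply: (mulfI (biadditive_neq0 fB x y)).
rewrite -(biadditiveDl fB) subrr (biadditive0l fB).
by rewrite mulfV ?(biadditive_neq0 fB).
Qed.

Lemma biadditive_mulz_eq1 (x y : G) m : f x y = 1 -> f (x *~ m) y = 1.
Proof.
move=> xy1; elim/int_ind: m => [|m IH|m IH]; first exact: biadditive0l.
  by rewrite intS mulrzDr (biadditiveDl fB) mulr1z xy1 mul1r.
rewrite intS opprD mulrzDr (biadditiveDl fB) IH mulrN1z biadditiveNl xy1.
by rewrite invr1 mulr1.
Qed.

Lemma biadditive_suml (I : Type) (r : seq I) (x : I -> G) y :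
  f (\sum_(i <- r) x i) y = \prod_(i <- r) f (x i) y.
Proof.
apply: (big_morph (f^~ y)) => [u v|]; last exact: biadditive0l.
exact: biadditiveDl.
Qed.

Lemma biadditive_sumr (I : Type) (r : seq I) x (y : I -> G) :
  f x (\sum_(i <- r) y i) = \prod_(i <- r) f x (y i).
Proof.
apply: (big_morph (f x)) => [u v|]; last exact: biadditive0r.
exact: biadditiveDr.
Qed.

End BiadditiveTheory.

Section MultiplierExists.
Variables (K : fieldType) (G : zmodType) (lam : G -> G -> K).
Hypothesis lamP : commutation_factor lam.
Hypothesis lam_even : forall x, lam x x = 1.

Let lamB : biadditive lam := lamP.1.

Lemma commutation_factorC (x y : G) : lam y x = (lam x y)^-1.
Proof.
apply: (mulfI (biadditive_neq0 lamB x y)).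
by rewrite lamP.2 mulfV ?(biadditive_neq0 lamB).
Qed.

(* For a decomposition into cyclic groups with components u_i, v_j of u, v,   *)
(* the upper triangular part of lam(v, u) is a multiplier.                    *)
Lemma multiplier_exists : finitely_generated G -> inhabited (multiplier lam).
Proof.
case=> s sG; have [y sy yb] := exists_basis (fun i : 'I_(size s) => s`_i).
have yG g : exists c, comb y c == g.
  have [c gE] := sG g; have [|d <-] := (sy g).1; last by exists d.
  by exists (\row_i c i); rewrite gE; apply: eq_bigr => i _; rewrite mxE.
pose part i g := y i *~ xchoose (yG g) 0 i.
have partE g : \sum_i part i g = g by apply/eqP/(xchooseP (yG g)).
(* The chosen coefficients need not be additive, but by [yb] the components they define are. *)
have partD i g h : part i (g + h) = part i g + part i h.
  have /yb/(_ i) :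
      comb y (xchoose (yG (g + h)) - xchoose (yG g) - xchoose (yG h)) = 0.
    rewrite !combB (eqP (xchooseP (yG _))) (eqP (xchooseP (yG g))).
    by rewrite (eqP (xchooseP (yG h))) addrAC addrK subrr.
  rewrite !mxE !mulrzBr -/(part i _) -/(part i g) -/(part i h).
  by rewrite -addrA -opprD => /eqP; rewrite subr_eq0 => /eqP.
pose sig u v := \prod_(i < size s) \prod_(j < size s | (i < j)%N)
  lam (part j v) (part i u).
have sigB : biadditive sig.
  split=> [u v|u v w|u v w].
  - apply/prodf_neq0 => i _; apply/prodf_neq0 => j _; exact: biadditive_neq0.
  - rewrite -big_split; apply: eq_bigr => i _; rewrite -big_split.
    by apply: eq_bigr => j _; rewrite partD (biadditiveDr lamB).
  - rewrite -big_split; apply: eq_bigr => i _; rewrite -big_split.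
    by apply: eq_bigr => j _; rewrite partD (biadditiveDl lamB).
constructor; apply: (@Multiplier _ _ _ sig sigB) => u v.
apply: (mulIf (biadditive_neq0 sigB v u)).
rewrite mulfVK ?(biadditive_neq0 sigB) // mul1r.
rewrite -{1}[u]partE -{1}[v]partE (biadditive_suml lamB).
under eq_bigr do rewrite (biadditive_sumr lamB).
rewrite /sig -big_split [RHS](exchange_big_dep predT) //=; apply: eq_bigr => i _.
rewrite [X in _ * X]big_mkcond -big_split [RHS]big_mkcond.
apply: eq_bigr => j _ /=.
(* For i < j the two factors on the left cancel, for j < i both sides are the same factor, and on
   the diagonal evenness makes [lam] trivial on the cyclic group of [y i]. *)
have [ij|ji|/val_inj->] := ltngtP i j; last 2 first.
- by rewrite mulr1.
- rewrite mulr1; apply: (biadditive_mulz_eq1 lamB); rewrite commutation_factorC.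
  by rewrite (biadditive_mulz_eq1 lamB) ?invr1.
by rewrite lamP.2.
Qed.
End MultiplierExists.

(** * Characterization of the determinant over a field *)

Section BlockUnipotent.
Variables (F : fieldType) (m : nat).
Implicit Types (v : 'rV[F]_m) (w : 'cV[F]_m) (a : F) (S : 'M[F]_m).

Definition upper_unip v : 'M[F]_(1 + m) := block_mx 1%:M v 0 1%:M.
Definition lower_unip w : 'M[F]_(1 + m) := block_mx 1%:M 0 w 1%:M.
Definition block_diag a S : 'M[F]_(1 + m) := block_mx a%:M 0 0 S.

Lemma det_upper_unip v : \det (upper_unip v) = 1.
Proof. by rewrite det_ublock !det1 mulr1. Qed.

Lemma det_lower_unip w : \det (lower_unip w) = 1.
Proof. by rewrite det_lblock !det1 mulr1. Qed.

Lemma det_block_diag a S : \det (block_diag a S) = a * \det S.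
Proof. by rewrite det_ublock det_scalar1. Qed.

Lemma mul_block_diag a b S T :
  block_diag a S *m block_diag b T = block_diag (a * b) (S *m T).
Proof.
by rewrite mulmx_block !(mulmx0, mul0mx, addr0, add0r) -scalar_mxM.
Qed.

(** Block elimination with pivot [a]; the lower block of the middle factor is the Schur
    complement. *)
Lemma block_factor a v w S : a != 0 ->
  block_mx a%:M v w S = lower_unip (a^-1 *: w)
    *m block_diag a (S - a^-1 *: (w *m v)) *m upper_unip (a^-1 *: v).
Proof.
move=> a0; rewrite !mulmx_block !(mulmx1, mul1mx, mulmx0, mul0mx, addr0, add0r).
rewrite mul_mx_scalar mul_scalar_mx !scalerA mulfV // !scale1r -scalemxAr.
by rewrite addrC subrK.
Qed.

Lemma mul_unip v w :
  upper_unip v *m lower_unip w = block_mx (1%:M + v *m w) v w 1%:M.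
Proof. by rewrite mulmx_block !mulmx1 !mul1mx !mulmx0 !add0r. Qed.

End BlockUnipotent.

Section DetCharacterization.
Variable F : fieldType.
Hypothesis F2 : 2%:R != 0 :> F.

Let mulmorph n (phi : 'M[F]_n -> F) :=
  {in unitmx &, {morph phi : M N / M *m N >-> M * N}}.

Lemma block_diag2_conj_upper m (v : 'rV[F]_m) :
  block_diag 2%:R 1%:M *m upper_unip v
    = upper_unip v *m upper_unip v *m block_diag 2%:R 1%:M.
Proof.
rewrite !mulmx_block !(mulmx1, mul1mx, mulmx0, mul0mx, addr0, add0r).
by rewrite mul_scalar_mx scaler_nat mulr2n.
Qed.

Lemma block_diag2_conj_lower m (w : 'cV[F]_m) :
  lower_unip w *m block_diag 2%:R 1%:M
    = block_diag 2%:R 1%:M *m (lower_unip w *m lower_unip w).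
Proof.
rewrite !mulmx_block !(mulmx1, mul1mx, mulmx0, mul0mx, addr0, add0r).
by rewrite mul_mx_scalar scaler_nat mulr2n.
Qed.

(* An invertible matrix conjugate to its own square is killed, and since 2 is *)
(* invertible this applies to the block unipotent matrices.                   *)
Lemma det_uniqueS n (phi : 'M[F]_n.+1 -> F) : mulmorph phi ->
    (forall a, a != 0 ->
       phi (diag_mx (\row_(i < n.+1) if i.+1 == n.+1 then a else 1)) = a) ->
  {in unitmx, phi =1 determinant}.
Proof.
elim: n phi => [|m IH] phi phiM phid.
  move=> M; rewrite unitmxE unitfE det_mx11 => M0.
  rewrite -[RHS]phid //; congr phi; apply/matrixP => i j.
  by rewrite !mxE !ord1 eqxx mulr1n.
pose U := @upper_unip F m.+1; pose L := @lower_unip F m.+1.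
pose D := @block_diag F m.+1.
have unitU v : U v \in unitmx by rewrite unitmxE det_upper_unip unitr1.
have unitL w : L w \in unitmx by rewrite unitmxE det_lower_unip unitr1.
have unitD a S : a != 0 -> S \in unitmx -> D a S \in unitmx.
  by move=> a0 uS; rewrite unitmxE det_block_diag unitrM unitfE a0 -unitmxE.
have phi1 : phi 1%:M = 1.
  rewrite -[RHS](phid 1) ?oner_eq0 //; congr phi; apply/matrixP => i j.
  by rewrite !mxE; case: ifP.
have phiN0 M : M \in unitmx -> phi M != 0.
  move=> uM; apply/eqP => M0; have := oner_neq0 F.
  by rewrite -phi1 -(mulmxV uM) phiM ?unitmx_inv // M0 mul0r eqxx.
have phi_idem (x : F) : x != 0 -> x = x * x -> x = 1.
  by move=> x0 xx; apply: (mulfI x0); rewrite mulr1 -xx.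
have u2 := unitD _ _ F2 (unitmx1 _ _).
have phiU v : phi (U v) = 1.
  apply: phi_idem; first exact: phiN0.
  apply: (mulfI (phiN0 _ u2)); rewrite -[LHS]phiM // block_diag2_conj_upper.
  by rewrite !phiM ?unitmx_mul ?unitU // mulrC.
have phiL w : phi (L w) = 1.
  apply: phi_idem; first exact: phiN0.
  apply: (mulfI (phiN0 _ u2)); rewrite mulrC -[LHS]phiM // block_diag2_conj_lower.
  by rewrite !phiM ?unitmx_mul ?unitL.
(* The induction hypothesis fits because the normalization puts [a] at the last index, which lies in
   the lower right block. *)
have phi1D : {in unitmx, forall S, phi (D 1 S) = \det S}.
  apply: IH => [S T uS uT|a a0].
    by rewrite -phiM ?unitD ?oner_eq0 // mul_block_diag mulr1.
  rewrite -[RHS]phid //; congr phi; rewrite /D /block_diag.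
  rewrite -[1%:M](_ : diag_mx (\row_i 1) = _).
    rewrite -diag_mx_row; congr diag_mx; apply/rowP=> i; rewrite !mxE.
    by case: splitP => j ij; rewrite !mxE ij ?ord1.
  by apply/matrixP => i j; rewrite !mxE.
have phiD a S : a != 0 -> S \in unitmx ->
    phi (D a S) = phi (D a 1%:M) * \det S.
  move=> a0 uS; rewrite -phi1D // -phiM ?unitD ?oner_eq0 ?unitmx1 //.
  by rewrite mul_block_diag mulr1 mul1mx.
have phiDa a : a != 0 -> phi (D a 1%:M) = a.
  (* [v] and [w] are chosen so that [U v *m L w] has corner entry [a]. Its value under [phi] is 1,
     while block elimination with pivot [a] gives [phi (D a 1%:M) * \det S], and [\det S] is the
     inverse of [a]. *)
  move=> a0; pose v : 'rV[F]_m.+1 := (a - 1) *: delta_mx 0 0.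
  pose w : 'cV[F]_m.+1 := delta_mx 0 0; pose S := 1%:M - a^-1 *: (w *m v).
  have eqUL : U v *m L w = L (a^-1 *: w) *m D a S *m U (a^-1 *: v).
    rewrite -block_factor // mul_unip -scalemxAl mul_delta_mx.
    congr block_mx; apply/matrixP => i j; rewrite !mxE !ord1 eqxx !mulr1n.
    by rewrite mulr1 addrC subrK.
  have detS : a * \det S = 1.
    have := congr1 determinant eqUL; rewrite !det_mulmx !det_upper_unip.
    by rewrite !det_lower_unip det_block_diag mulr1 mul1r mulr1.
  have uS : S \in unitmx.
    rewrite unitmxE unitfE; apply: contra_eq_neq detS => ->.
    by rewrite mulr0 eq_sym oner_eq0.
  have := congr1 phi eqUL; rewrite !phiM ?unitmx_mul ?unitU ?unitL ?unitD //.
  rewrite !phiU !phiL !mulr1 mul1r phiD // => phiaS.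
  by apply: (mulIf (_ : \det S != 0)); rewrite ?detS //-unitfE -unitmxE.
have phi_corner a (v : 'rV_m.+1) (w : 'cV_m.+1) T : a != 0 ->
    block_mx a%:M v w T \in unitmx ->
    phi (block_mx a%:M v w T) = \det (block_mx a%:M v w T).
  move=> a0; rewrite block_factor // -/(L _) -/(D _ _) -/(U _).
  set S := T - _; rewrite !unitmx_mul unitU unitL andbT /= => uDS.
  have uS : S \in unitmx.
    by move: uDS; rewrite !unitmxE det_block_diag unitrM => /andP[].
  rewrite !det_mulmx det_upper_unip det_lower_unip mul1r mulr1 det_block_diag.
  rewrite !phiM ?unitmx_mul ?unitU ?unitL ?uDS // phiU phiL mul1r mulr1.
  by rewrite phiD // phiDa.
move=> M; rewrite -[M](@submxK _ 1 m.+1 1 m.+1) => uM.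
move: (@ulsubmx _ 1 m.+1 1 m.+1 M) (@ursubmx _ 1 m.+1 1 m.+1 M)
      (@dlsubmx _ 1 m.+1 1 m.+1 M) (@drsubmx _ 1 m.+1 1 m.+1 M) uM.
move=> A v w T; rewrite [A]mx11_scalar; move: (A 0 0) => a uM.
have [a0|] := eqVneq a 0; last by move=> a0; apply: phi_corner.
(* With a zero corner, invertibility forces a nonzero entry below it; adding that row to the first,
   by a unipotent factor, creates a nonzero pivot. *)
have /existsP[i wi] : [exists i, w i 0 != 0].
  apply: contraLR uM => /existsPn w0; rewrite (_ : w = 0).
    by rewrite a0 unitmxE [\det _](det_ublock 0%:M v T) det_scalar1 mul0r unitr0.
  by apply/colP=> i; rewrite mxE; apply/eqP; have := w0 i; rewrite negbK.
have uUM : U (delta_mx 0 i) *m block_mx a%:M v w T \in unitmx.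
  by rewrite unitmx_mul unitU.
have -> : \det (block_mx a%:M v w T)
    = \det (U (delta_mx 0 i) *m block_mx a%:M v w T).
  by rewrite det_mulmx det_upper_unip mul1r.
rewrite -[LHS]mul1r -(phiU (delta_mx 0 i)) -phiM //.
move: uUM; rewrite mulmx_block !mul1mx; set A' := _ + _.
rewrite [A']mx11_scalar; apply: phi_corner.
by rewrite /A' a0 !mxE add0r (bigD1 i) //= big1 => [|j ji];
  rewrite !mxE ?eqxx ?mul1r ?addr0 // (negPf ji) mul0r.
Qed.

Lemma det_unique n (phi : 'M[F]_n -> F) : (0 < n)%N -> mulmorph phi ->
    (forall a, a != 0 ->
       phi (diag_mx (\row_(i < n) if i.+1 == n then a else 1)) = a) ->
  {in unitmx, phi =1 determinant}.
Proof. by case: n phi => // n phi _; apply: det_uniqueS. Qed.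
End DetCharacterization.

(** * The determinant attached to a multiplier *)

Section StarGrading.
Variables (K : fieldType) (G : zmodType) (lam : G -> G -> K).
Variables (sig : multiplier lam) (A : glAlg lam).
Implicit Types a b : A.

Let sB := mult_biadditive sig.

Lemma starZr (k : K) a b : star sig a (k *: b) = k *: star sig a b.
Proof. by rewrite starC starZl starC. Qed.

Lemma star_homM g h a b : a \in hom A g -> b \in hom A h ->
  star sig a b \in hom A (g + h).
Proof. by move=> ha hb; rewrite (star_hom _ ha hb) homZ ?homM. Qed.

Lemma star_hom0 a b : a \in hom A 0 -> b \in hom A 0 -> star sig a b = a * b.
Proof. by move=> ha hb; rewrite (star_hom _ ha hb) (biadditive0l sB) scale1r. Qed.

Lemma star_prod_hom (I : finType) (g : I -> G) (F : I -> underline A sig) :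
  (forall i, F i \in hom A (g i)) -> \prod_i F i \in hom A (\sum_i g i).
Proof.
move=> hF; apply: (big_ind2 (fun (a : A) x => a \in hom A x)) => //.
  exact: hom1.
by move=> a x b y; apply: star_homM.
Qed.

End StarGrading.

Section UnderlineMorphism.
Variables (K : fieldType) (G : zmodType) (lam : G -> G -> K).
Variables (sig : multiplier lam) (A B : glAlg lam) (f : glMor A B).

Lemma glm_star : {morph f : a b / star sig a b}.
Proof.
elim/Defs.hom_ind => [b|a a' IH IH' b|g a ha].
- by rewrite star0a raddf0 star0a.
- by rewrite starDl !raddfD /= IH IH' starDl.
elim/Defs.hom_ind => [|b b' IH IH'|h b hb].
- by rewrite stara0 raddf0 stara0.
- by rewrite starDr !raddfD /= IH IH' starDr.
rewrite (star_hom _ ha hb) linearZ rmorphM.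
by rewrite (star_hom _ (glm_hom f ha) (glm_hom f hb)).
Qed.

Lemma glmZ (k : K) a : f (k *: a) = k *: f a.
Proof. exact: linearZ. Qed.

Definition underline_mor (a : underline A sig) : underline B sig := f a.

Fact underline_mor_zmod : zmod_morphism underline_mor.
Proof. exact: (raddfB f). Qed.

Fact underline_mor_monoid : monoid_morphism underline_mor.
Proof. by split; [exact: (rmorph1 f) | exact: glm_star]. Qed.

HB.instance Definition _ := GRing.isZmodMorphism.Build
  (underline A sig) (underline B sig) underline_mor underline_mor_zmod.
HB.instance Definition _ := GRing.isMonoidMorphism.Build
  (underline A sig) (underline B sig) underline_mor underline_mor_monoid.
End UnderlineMorphism.

Section Determinant.
Variables (K : fieldType) (G : zmodType) (lam : G -> G -> K).
Variables (sig : multiplier lam) (n : nat) (nu : 'I_n -> G).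

Let sB := mult_biadditive sig.

(** Splitting nu k as (nu k - nu i) + nu i in [sig (nu k) (nu j - nu k)] yields exactly the star
    twist of the entries (i, k) and (k, j); the remaining factors form the scalar of the entry (i,
    j). *)
Lemma JM (A : glAlg lam) (X Y : 'M[A]_n) :
  X \in degree0 nu A -> Y \in degree0 nu A ->
  J nu sig (X * Y) = J nu sig X *m J nu sig Y.
Proof.
move=> /degree0P hX /degree0P hY; apply/matrixP => i j; rewrite !mxE scaler_sumr.
apply: eq_bigr => k _; rewrite !mxE underlineM starZl starZr.
rewrite (star_hom _ (hX i k) (hY k j)) !scalerA; congr (_ *: _).
have e : nu j - nu i = (nu k - nu i) + (nu j - nu k).
  by rewrite [RHS]addrC addrA subrK.
rewrite e (biadditiveDr sB).
have := biadditiveDl sB (nu k - nu i) (nu i) (nu j - nu k).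
rewrite subrK => ->; rewrite !invfM -!mulrA; congr (_ * _).
by rewrite mulrA mulrC mulrA mulfV ?mul1r ?(biadditive_neq0 sB).
Qed.

Lemma J1 (A : glAlg lam) : J nu sig (1 : 'M[A]_n) = 1%:M.
Proof.
apply/matrixP => i j; rewrite !mxE; case: eqP => [->|_]; last exact: scaler0.
by rewrite subrr (biadditive0r sB) invr1 scale1r.
Qed.

(** The Leibniz term of a permutation s has degree the sum of all nu (s i) - nu i, which is 0 after
    reindexing. *)
Lemma det_J_hom0 (A : glAlg lam) (X : 'M[A]_n) :
  X \in degree0 nu A -> \det (J nu sig X) \in hom A 0.
Proof.
move=> /degree0P hX; apply: hom_sum => s _.
have -> : 0 = \sum_(i < n) (nu (s i) - nu i).
  rewrite sumrB [X in _ - X](reindex_inj (h := s)) ?subrr //.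
  exact: perm_inj.
have h : \prod_(i < n) J nu sig X i (s i)
    \in hom A (\sum_(i < n) (nu (s i) - nu i)).
  by apply: star_prod_hom => i; rewrite mxE homZ.
by rewrite mulr_sign; case: (odd_perm s) => //; apply: homN.
Qed.

Lemma det_JM (A : glAlg lam) (X Y : 'M[A]_n) :
  X \in degree0 nu A -> Y \in degree0 nu A ->
  \det (J nu sig (X * Y)) = (\det (J nu sig X) : A) * \det (J nu sig Y).
Proof.
by move=> hX hY; rewrite JM // det_mulmx underlineM star_hom0 ?det_J_hom0.
Qed.

Fact gdet_subproof (A : glAlg lam) (X : GL0 nu A) :
  [&& \det (J nu sig (uval X)) \in homZ0 A, \det (J nu sig (uinv X)) \in homZ0 A,
      (\det (J nu sig (uval X)) : A) * \det (J nu sig (uinv X)) == 1 &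
      (\det (J nu sig (uinv X)) : A) * \det (J nu sig (uval X)) == 1].
Proof.
have hX := uval_in X; have hX' := uinv_in X.
apply/and4P; split; [exact: det_J_hom0 | exact: det_J_hom0 | |];
  by rewrite -det_JM ?(uvalV X, uinvV X) // J1 det1.
Qed.

Definition gdet (A : glAlg lam) (X : GL0 nu A) : units0 A :=
  UnitsIn (gdet_subproof X).

Lemma gdet_natural : natural_group_morphism nu gdet.
Proof.
split=> [A X Y|A B f X]; apply: uval_inj => /=.
  by rewrite det_JM ?uval_in.
have -> : J nu sig (map_mx f (uval X))
    = map_mx (@underline_mor _ _ _ sig A B f) (J nu sig (uval X)).
  by apply/matrixP => i j; rewrite !mxE /underline_mor glmZ.
exact: (det_map_mx (@underline_mor _ _ _ sig A B f) (J nu sig (uval X))).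
Qed.

Lemma gdet_diag_last (A : glAlg lam) (a : units0 A) : (0 < n)%N ->
  gdet (diag_last nu a) = a.
Proof.
move=> n_gt0; apply: uval_inj => /=.
have -> : J nu sig (diag_last_mx n (uval a))
    = diag_mx (\row_(i < n) if i.+1 == n then uval a else 1 : underline A sig).
  apply/matrixP => i j; rewrite !mxE; case: (i =P j) => [->|_]; last first.
    by rewrite !mulr0n scaler0.
  by rewrite subrr (biadditive0r sB) invr1 scale1r.
rewrite det_diag; case: n n_gt0 => // m _; rewrite big_ord_recr /= mxE eqxx.
rewrite big1 ?mul1r // => i _; rewrite mxE /= eqSS.
by have /ltn_eqF := ltn_ord i; rewrite /= => ->.
Qed.
End Determinant.

(** * Twisted group algebras *)

Section MalgExtension.
Variables (G : choiceType) (L V : zmodType) (F : G -> L -> V).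
Hypothesis F0 : forall x, F x 0 = 0.
Hypothesis FD : forall x a b, F x (a + b) = F x a + F x b.

Definition malg_ext (f : {malg L[G]}) : V := \sum_(x <- msupp f) F x f@_x.

Lemma malg_extE (d : {fset G}) f : (msupp f `<=` d)%fset ->
  malg_ext f = \sum_(x <- d) F x f@_x.
Proof.
move=> fd; apply/big_fset_incl => // x _ xf.
by rewrite mcoeff_outdom ?F0.
Qed.

Lemma malg_extD f g : malg_ext (f + g) = malg_ext f + malg_ext g.
Proof.
rewrite (malg_extE (msuppD_le f g)).
rewrite (malg_extE (fsubsetUl (msupp f) (msupp g))).
rewrite (malg_extE (fsubsetUr (msupp f) (msupp g))) -big_split.
by apply: eq_bigr => x _; rewrite mcoeffD FD.
Qed.

Lemma malg_ext0 : malg_ext 0 = 0.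
Proof. by rewrite /malg_ext msupp0 big_seq_fset0. Qed.

Lemma malg_extU x a : malg_ext << a *g x >> = F x a.
Proof. by rewrite (malg_extE msuppU_le) big_seq_fset1 mcoeffUU. Qed.

End MalgExtension.

Lemma malg_ind (G : choiceType) (L : zmodType) (P : {malg L[G]} -> Prop) :
  P 0 -> (forall f g, P f -> P g -> P (f + g)) ->
  (forall x a, P << a *g x >>) -> forall f, P f.
Proof. by move=> P0 PD PU f; rewrite [f]monalgE; elim/big_ind: _. Qed.

(** L[Gamma] with e_x e_y = sig(x, y)^-1 e_(x+y): the commutation factor is then [lam], and the star
    product for [sig] is the product of the ordinary group algebra. [sig] and [iota] are parameters
    of the type so that the product and the K-action can be attached to it. *)
Definition twist (K : fieldType) (G : zmodType) (lam : G -> G -> K)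
  (sig : multiplier lam) (L : comNzRingType) (iota : {rmorphism K -> L}) : Type :=
  {malg L[G]}.

Section TwistAlgebra.
Variables (K : fieldType) (G : zmodType) (lam : G -> G -> K).
Variables (sig : multiplier lam) (L : comNzRingType) (iota : {rmorphism K -> L}).

Local Notation T := (twist sig iota).
HB.instance Definition _ := GRing.Zmodule.on T.

Definition twistU (x : G) (a : L) : T := << a *g x >>.

Lemma twistUD x a b : twistU x (a + b) = twistU x a + twistU x b.
Proof. exact: monalgUD. Qed.
Lemma twistU0 x : twistU x 0 = 0.
Proof. exact: monalgU0. Qed.

Lemma twist_ind (P : T -> Prop) :
  P 0 -> (forall f g, P f -> P g -> P (f + g)) ->
  (forall x a, P (twistU x a)) -> forall f, P f.
Proof. exact: malg_ind. Qed.

Definition twist_scale (k : K) (f : T) : T := iota k *: (f : {malg L[G]}).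

Fact twist_scaleA k l f :
  twist_scale k (twist_scale l f) = twist_scale (k * l) f.
Proof. by rewrite /twist_scale scalerA rmorphM. Qed.
Fact twist_scale1 : left_id 1 twist_scale.
Proof. by move=> f; rewrite /twist_scale rmorph1 scale1r. Qed.
Fact twist_scaleDr : right_distributive twist_scale +%R.
Proof. by move=> k f g; rewrite /twist_scale scalerDr. Qed.
Fact twist_scaleDl f : {morph twist_scale^~ f : k l / k + l}.
Proof. by move=> k l; rewrite /twist_scale rmorphD scalerDl. Qed.

HB.instance Definition _ := GRing.Zmodule_isLmodule.Build K T
  twist_scaleA twist_scale1 twist_scaleDr twist_scaleDl.

Lemma twist_scaleU k x a : k *: twistU x a = twistU x (iota k * a).
Proof.
apply/malgP => y; rewrite [LHS]mcoeffZ !mcoeffU.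
by case: (x == y); rewrite ?mulr1n // !mulr0n mulr0.
Qed.

Definition twist_mul1 (x : G) (a : L) (g : T) : T :=
  malg_ext (fun y b => twistU (x + y) (iota (sig x y)^-1 * (a * b))) g.

Definition twist_mul (f g : T) : T := malg_ext (fun x a => twist_mul1 x a g) f.

Lemma twist_mul1D x a b g :
  twist_mul1 x (a + b) g = twist_mul1 x a g + twist_mul1 x b g.
Proof.
rewrite /twist_mul1 /malg_ext -big_split; apply: eq_bigr => y _.
by rewrite mulrDl mulrDr twistUD.
Qed.
Lemma twist_mul10 x g : twist_mul1 x 0 g = 0.
Proof. by apply: (addrI (twist_mul1 x 0 g)); rewrite -twist_mul1D !addr0. Qed.

Lemma twist_mulDl f f' g : twist_mul (f + f') g = twist_mul f g + twist_mul f' g.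
Proof.
apply: malg_extD => [x|x a b]; [exact: twist_mul10 | exact: twist_mul1D].
Qed.
Lemma twist_mul0l g : twist_mul 0 g = 0. Proof. exact: malg_ext0. Qed.

Lemma twist_mul1Dr x a g g' :
  twist_mul1 x a (g + g') = twist_mul1 x a g + twist_mul1 x a g'.
Proof.
apply: malg_extD => [y|y b b']; first by rewrite !mulr0 twistU0.
by rewrite !mulrDr twistUD.
Qed.

Lemma twist_mulDr f g g' : twist_mul f (g + g') = twist_mul f g + twist_mul f g'.
Proof.
rewrite /twist_mul /malg_ext -big_split; apply: eq_bigr => x _.
exact: twist_mul1Dr.
Qed.
Lemma twist_mul0r f : twist_mul f 0 = 0.
Proof. by apply: (addrI (twist_mul f 0)); rewrite -twist_mulDr !addr0. Qed.

Lemma twist_mulU x a y b : twist_mul (twistU x a) (twistU y b)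
  = twistU (x + y) (iota (sig x y)^-1 * (a * b)).
Proof.
rewrite /twist_mul malg_extU => [|z]; last exact: twist_mul10.
by rewrite /twist_mul1 malg_extU // => z; rewrite !mulr0 twistU0.
Qed.

Let sB := mult_biadditive sig.

Fact twist_mulA : associative twist_mul.
Proof.
elim/twist_ind => [g h|f f' IH IH' g h|x a]; first by rewrite !twist_mul0l.
  by rewrite !twist_mulDl IH IH'.
elim/twist_ind => [h|f f' IH IH' h|y b].
- by rewrite !(twist_mul0l, twist_mul0r).
- by rewrite twist_mulDl !twist_mulDr twist_mulDl IH IH'.
elim/twist_ind => [|f f' IH IH'|z c]; first by rewrite !twist_mul0r.
  by rewrite !twist_mulDr IH IH'.
rewrite !twist_mulU addrA (biadditiveDl sB) (biadditiveDr sB); congr twistU.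
rewrite !invfM !rmorphM; move: (iota _) (iota _) (iota _) => p q r.
ring.
Qed.

Definition twist_one : T := twistU 0 1.

Fact twist_mul1l : left_id twist_one twist_mul.
Proof.
elim/twist_ind => [|f f' IH IH'|y b]; first exact: twist_mul0r.
  by rewrite twist_mulDr IH IH'.
by rewrite twist_mulU (biadditive0l sB) invr1 rmorph1 !mul1r add0r.
Qed.
Fact twist_mul1r : right_id twist_one twist_mul.
Proof.
elim/twist_ind => [|f f' IH IH'|y b]; first exact: twist_mul0l.
  by rewrite twist_mulDl IH IH'.
by rewrite twist_mulU (biadditive0r sB) invr1 rmorph1 mul1r mulr1 addr0.
Qed.

Fact twist_linl g : linear (twist_mul^~ g).
Proof.
move=> k f f'; rewrite twist_mulDl; congr (_ + _).
elim/twist_ind: f g => [|f1 f2 IH IH'|x a] g.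
- by rewrite scaler0 twist_mul0l scaler0.
- by rewrite scalerDr !twist_mulDl scalerDr IH IH'.
elim/twist_ind: g => [|f1 f2 IH IH'|y b].
- by rewrite !twist_mul0r scaler0.
- by rewrite !twist_mulDr scalerDr IH IH'.
rewrite !(twist_scaleU, twist_mulU); congr twistU.
ring.
Qed.
Fact twist_linr f : linear (twist_mul f).
Proof.
move=> k g g'; rewrite twist_mulDr; congr (_ + _).
elim/twist_ind: g f => [|f1 f2 IH IH'|x a] f.
- by rewrite scaler0 twist_mul0r scaler0.
- by rewrite scalerDr !twist_mulDr scalerDr IH IH'.
elim/twist_ind: f => [|f1 f2 IH IH'|y b].
- by rewrite !twist_mul0l scaler0.
- by rewrite !twist_mulDl scalerDr IH IH'.
rewrite !(twist_scaleU, twist_mulU); congr twistU.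
ring.
Qed.

Definition twist_hom (x : G) : {pred T} :=
  fun f => f == twistU x (f : {malg L[G]})@_x.

Lemma twist_homP x (f : T) : reflect (exists a, f = twistU x a) (f \in twist_hom x).
Proof.
apply: (iffP eqP) => [->|[a ->]]; first by eexists.
by rewrite mcoeffUU.
Qed.

Lemma twistU_hom x a : twistU x a \in twist_hom x.
Proof. by apply/twist_homP; exists a. Qed.

Fact twist_submod x : submod_closed (twist_hom x).
Proof.
split=> [|k _ _ /twist_homP[a ->] /twist_homP[b ->]].
  by rewrite -(twistU0 x) twistU_hom.
by rewrite twist_scaleU -twistUD twistU_hom.
Qed.

Fact twist_span (f : T) : exists (s : seq G) (c : G -> T),
  (forall x, c x \in twist_hom x) /\ f = \sum_(x <- s) c x.
Proof.
exists (msupp (f : {malg L[G]})), (fun x => twistU x (f : {malg L[G]})@_x).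
by split=> [x|]; [exact: twistU_hom | exact: monalgE].
Qed.

Fact twist_direct (s : seq G) (c : G -> T) : uniq s ->
  (forall x, c x \in twist_hom x) -> \sum_(x <- s) c x = 0 ->
  forall x, x \in s -> c x = 0.
Proof.
move=> us hc sc x xs; have /twist_homP[a cx] := hc x.
have /(congr1 (mcoeff x)) := sc; rewrite mcoeff0 raddf_sum (bigD1_seq x) //=.
rewrite cx mcoeffUU big1 => [|y yx]; first by rewrite addr0 => ->; apply: twistU0.
by have /twist_homP[b ->] := hc y; rewrite mcoeffU (negPf yx).
Qed.

Fact twist_hom1 : twist_one \in twist_hom 0. Proof. exact: twistU_hom. Qed.

Fact twist_homM x y f g : f \in twist_hom x -> g \in twist_hom y ->
  twist_mul f g \in twist_hom (x + y).
Proof.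
by move=> /twist_homP[a ->] /twist_homP[b ->]; rewrite twist_mulU twistU_hom.
Qed.

Fact twist_comm x y f g : f \in twist_hom x -> g \in twist_hom y ->
  twist_mul f g = lam x y *: twist_mul g f.
Proof.
move=> /twist_homP[a ->] /twist_homP[b ->].
rewrite !twist_mulU twist_scaleU addrC [b * a]mulrC; congr twistU.
rewrite [RHS]mulrA -rmorphM; congr (iota _ * _).
apply: (mulIf (biadditive_neq0 sB x y)); rewrite mulVf ?(biadditive_neq0 sB) //.
by rewrite mulrAC multP.
Qed.

Definition twist_alg : glAlg lam := @GLAlg K G lam T twist_one twist_mul
  twist_mulA twist_mul1l twist_mul1r twist_linl twist_linr twist_hom
  twist_submod twist_span twist_direct twist_hom1 twist_homM twist_comm.

End TwistAlgebra.

Section TwistUnits.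
Variables (K : fieldType) (G : zmodType) (lam : G -> G -> K).
Variables (sig : multiplier lam) (L : comNzRingType) (iota : {rmorphism K -> L}).

Local Notation T := (twist_alg sig iota).

Let sB := mult_biadditive sig.

Definition twist_elt (x : G) (a : L) : T := twistU sig iota x a.

Lemma twist_eltM x y a b :
  twist_elt x a * twist_elt y b = twist_elt (x + y) (iota (sig x y)^-1 * (a * b)).
Proof. exact: twist_mulU. Qed.

Lemma twist_elt_hom x a : twist_elt x a \in hom T x.
Proof. exact: twistU_hom. Qed.

Lemma twist_elt_homP x (f : T) : f \in hom T x -> exists a, f = twist_elt x a.
Proof. by move/twist_homP. Qed.

Lemma twist_elt_sum x (I : finType) (F : I -> L) :
  \sum_i twist_elt x (F i) = twist_elt x (\sum_i F i).
Proof.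
by symmetry; apply: (big_morph (twist_elt x)); [exact: twistUD | exact: twistU0].
Qed.

Definition coef0 (f : T) : L := mcoeff 0 (f : {malg L[G]}).

Lemma coef0K a : coef0 (twist_elt 0 a) = a.
Proof. exact: mcoeffUU. Qed.

Section Lift.
Variables (n : nat) (nu : 'I_n -> G).

(* The inverse of J, identifying GL_n(L) with a group of degree-0 matrices.   *)
Definition lift_mx (M : 'M[L]_n) : 'M[T]_n :=
  \matrix_(i, j) twist_elt (nu j - nu i) (iota (sig (nu i) (nu j - nu i)) * M i j).

Lemma lift_mx_degree0 M : lift_mx M \in degree0 nu T.
Proof. by apply/degree0P => i j; rewrite mxE twist_elt_hom. Qed.

Lemma lift_mxM M N : lift_mx (M *m N) = lift_mx M * lift_mx N.
Proof.
apply/matrixP => i j; rewrite !mxE mulr_sumr -twist_elt_sum.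
apply: eq_bigr => k _; rewrite !mxE twist_eltM.
have e : nu j - nu i = (nu k - nu i) + (nu j - nu k).
  by rewrite [RHS]addrC addrA subrK.
rewrite -e; congr twist_elt.
have <- : sig (nu i) (nu k - nu i) * sig (nu k) (nu j - nu k)
          / sig (nu k - nu i) (nu j - nu k) = sig (nu i) (nu j - nu i).
  have := biadditiveDl sB (nu k - nu i) (nu i) (nu j - nu k).
  rewrite subrK => ->; rewrite e (biadditiveDr sB (nu i) (nu k - nu i)).
  by rewrite mulrCA mulrAC mulfV ?mul1r ?(biadditive_neq0 sB).
rewrite !rmorphM; ring.
Qed.

Lemma lift_mx1 : lift_mx 1%:M = 1.
Proof.
apply/matrixP => i j; rewrite !mxE; case: (i =P j) => [->|_]; last first.
  by rewrite mulr0n mulr0; apply: twistU0.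
by rewrite subrr (biadditive0r sB) rmorph1 mulr1.
Qed.

Lemma lift_diag_last_mx a :
  lift_mx (diag_mx (\row_(i < n) if i.+1 == n then a else 1))
    = diag_last_mx n (twist_elt 0 a).
Proof.
apply/matrixP => i j; rewrite !mxE; case: (i =P j) => [->|_]; last first.
  by rewrite !mulr0n mulr0; apply: twistU0.
rewrite subrr (biadditive0r sB) rmorph1 mul1r !mulr1n.
by case: ifP.
Qed.

Definition inverses (M N : 'M[L]_n) : bool :=
  (M *m N == 1%:M) && (N *m M == 1%:M).

Fact lift_subproof M N : inverses M N ->
  [&& lift_mx M \in degree0 nu T, lift_mx N \in degree0 nu T,
      lift_mx M * lift_mx N == 1 & lift_mx N * lift_mx M == 1].
Proof.
case/andP=> /eqP MN /eqP NM; rewrite !lift_mx_degree0 -!lift_mxM MN NM.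
by rewrite lift_mx1 eqxx.
Qed.

Definition lift_GL0 M N (MN : inverses M N) : GL0 nu T :=
  UnitsIn (lift_subproof MN).

End Lift.
End TwistUnits.

Section TwistMap.
Variables (K : fieldType) (G : zmodType) (lam : G -> G -> K).
Variables (sig : multiplier lam) (L L' : comNzRingType).
Variables (iota : {rmorphism K -> L}) (iota' : {rmorphism K -> L'}).
Variable phi : {rmorphism L -> L'}.
Hypothesis phi_iota : forall k, phi (iota k) = iota' k.

Local Notation T := (twist_alg sig iota).
Local Notation T' := (twist_alg sig iota').

Definition twist_map (f : T) : T' :=
  malg_ext (fun x a => twist_elt sig iota' x (phi a)) f.

Lemma twist_mapU x a :
  twist_map (twist_elt sig iota x a) = twist_elt sig iota' x (phi a).
Proof. by apply: malg_extU => y; rewrite rmorph0; apply: twistU0. Qed.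

Lemma twist_mapD f g : twist_map (f + g) = twist_map f + twist_map g.
Proof.
apply: malg_extD => [x|x a b]; first by rewrite rmorph0; apply: twistU0.
by rewrite rmorphD; apply: twistUD.
Qed.

Lemma twist_map0 : twist_map 0 = 0. Proof. exact: malg_ext0. Qed.

Fact twist_map_linear : linear twist_map.
Proof.
move=> k f g; rewrite twist_mapD; congr (_ + _).
elim/twist_ind: f => [|f f' IH IH'|x a].
- by rewrite scaler0 twist_map0 scaler0.
- by rewrite scalerDr !twist_mapD scalerDr IH IH'.
rewrite [k *: _]twist_scaleU !twist_mapU rmorphM phi_iota.
by rewrite [RHS]twist_scaleU.
Qed.

Fact twist_map_monoid : GRing.monoid_morphism twist_map.
Proof.
split; first by rewrite [LHS]twist_mapU rmorph1.
elim/twist_ind => [g|f f' IH IH' g|x a].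
- by rewrite mul0r twist_map0 mul0r.
- by rewrite mulrDl !twist_mapD IH IH' mulrDl.
elim/twist_ind => [|f f' IH IH'|y b].
- by rewrite mulr0 twist_map0 mulr0.
- by rewrite mulrDr !twist_mapD IH IH' mulrDr.
by rewrite twist_eltM !twist_mapU twist_eltM !rmorphM phi_iota.
Qed.

Fact twist_map_hom x f : f \in hom T x -> twist_map f \in hom T' x.
Proof. by case/twist_elt_homP=> a ->; rewrite twist_mapU twist_elt_hom. Qed.

Definition twist_mor : glMor T T' :=
  GLMor twist_map_linear twist_map_monoid twist_map_hom.

Lemma coef0_twist_map f : f \in hom T 0 -> coef0 (twist_map f) = phi (coef0 f).
Proof. by case/twist_elt_homP=> a ->; rewrite twist_mapU !coef0K. Qed.

Lemma lift_map n (nu : 'I_n -> G) M N (MN : inverses M N) M' N'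
    (MN' : inverses M' N') : map_mx phi M = M' ->
  GL0_map nu twist_mor (lift_GL0 sig iota nu MN) = lift_GL0 sig iota' nu MN'.
Proof.
move=> MM'; apply: uval_inj; apply/matrixP => i j; rewrite /= -MM' !mxE.
by rewrite twist_mapU rmorphM phi_iota.
Qed.
End TwistMap.

(** * The coaction into a twisted group algebra *)

Section Coaction.
Variables (K : fieldType) (G : zmodType) (lam : G -> G -> K).
Variables (sig : multiplier lam) (A : glAlg lam).
Variables (L : comNzRingType) (iota : {rmorphism K -> L}).
Variable u : {rmorphism underline A sig -> L}.
Hypothesis uZ : forall k (a : underline A sig), u (k *: a) = iota k * u a.

Local Notation T := (twist_alg sig iota).

Let sB := mult_biadditive sig.

Let F (x : G) (a : A) : T := twist_elt sig iota x (u a).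

Lemma coact_summand0 x : F x 0 = 0.
Proof. by rewrite /F raddf0; apply: twistU0. Qed.

Lemma coact_summandD x a b : F x (a + b) = F x a + F x b.
Proof. by rewrite /F raddfD; apply: twistUD. Qed.

Definition coact (a : A) : T := \sum_(p <- dec a) F p.1 p.2.

Lemma coactE a s : is_dec a s -> coact a = \sum_(p <- s) F p.1 p.2.
Proof.
exact: is_dec_sum coact_summand0 coact_summandD (Defs.decP a).
Qed.

Lemma coact_hom g a : a \in hom A g -> coact a = twist_elt sig iota g (u a).
Proof. by move/is_dec1/coactE->; rewrite big_seq1. Qed.

Lemma coactD a b : coact (a + b) = coact a + coact b.
Proof. by rewrite (coactE (is_decD (Defs.decP a) (Defs.decP b))) big_cat. Qed.

Lemma coact0 : coact 0 = 0.
Proof. by apply: (addrI (coact 0)); rewrite -coactD !addr0. Qed.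

Fact coact_linear : linear coact.
Proof.
move=> k a b; rewrite coactD; congr (_ + _).
elim/Defs.hom_ind: a => [|a a' IH IH'|g a ha].
- by rewrite scaler0 coact0 scaler0.
- by rewrite scalerDr !coactD scalerDr IH IH'.
by rewrite (coact_hom ha) (coact_hom (homZ k ha)) uZ [RHS]twist_scaleU.
Qed.

(** In degrees g and h, u(a) u(b) is sig(g, h) u(ab), and this scalar cancels the sig(g, h)^-1 of
    the twisted product. *)
Fact coact_monoid : GRing.monoid_morphism coact.
Proof.
split; first by rewrite (coact_hom (hom1 A)) rmorph1.
elim/Defs.hom_ind => [b|a a' IH IH' b|g a ha].
- by rewrite mul0r coact0 mul0r.
- by rewrite mulrDl !coactD IH IH' mulrDl.
elim/Defs.hom_ind => [|b b' IH IH'|h b hb].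
- by rewrite mulr0 coact0 mulr0.
- by rewrite mulrDr !coactD IH IH' mulrDr.
rewrite (coact_hom ha) (coact_hom hb) (coact_hom (homM ha hb)) twist_eltM.
congr twist_elt; rewrite -rmorphM underlineM (star_hom _ ha hb) uZ mulrA -rmorphM.
by rewrite mulVf ?(biadditive_neq0 sB) // rmorph1 mul1r.
Qed.

Fact coact_homog g a : a \in hom A g -> coact a \in hom T g.
Proof. by move=> ha; rewrite (coact_hom ha) twist_elt_hom. Qed.

Definition coaction : glMor A T := GLMor coact_linear coact_monoid coact_homog.

(** The scalars of [lift_mx] undo those of [J], so the coaction turns an arbitrary X into the lift
    of an ordinary invertible matrix. *)
Lemma coaction_lift n (nu : 'I_n -> G) (X : GL0 nu A) M N (MN : inverses M N) :
  map_mx u (J nu sig (uval X)) = M ->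
  GL0_map nu coaction X = lift_GL0 sig iota nu MN.
Proof.
move=> XM; apply: uval_inj; apply/matrixP => i j; rewrite /= -XM !mxE.
have /degree0P hX := uval_in X.
rewrite uZ mulrA -rmorphM mulfV ?(biadditive_neq0 sB) // rmorph1 mul1r.
exact: coact_hom.
Qed.
End Coaction.

(** * The generic matrix *)

(* Imported only here because its coefficient notation hides that of monalg. *)
From mathcomp Require Import mpoly.

Section GenericMatrix.
Variables (K : fieldType) (n : nat).

Local Notation P := (mpoly.mpoly (n * n) K).

Definition gen_mx : 'M[P]_n :=
  \matrix_(i, j) mpoly.mpolyX K (mpoly.mnm1 (mxvec_index i j)).

Definition gen_det : P := \det gen_mx.

Definition gen_eval (L : comNzRingType) (iota : {rmorphism K -> L})
    (M : 'M[L]_n) : P -> L :=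
  mpoly.mmap iota (fun k => mxvec M 0 k).

HB.instance Definition _ L iota M :=
  GRing.RMorphism.on (@gen_eval L iota M).

Section Eval.
Variables (L : comNzRingType) (iota : {rmorphism K -> L}) (M : 'M[L]_n).

Lemma map_gen_eval : map_mx (gen_eval iota M) gen_mx = M.
Proof.
apply/matrixP => i j; rewrite !mxE /gen_eval mpoly.mmapX mpoly.mmap1U.
by rewrite mxvecE.
Qed.

Lemma gen_eval_det : gen_eval iota M gen_det = \det M.
Proof. by rewrite -det_map_mx map_gen_eval. Qed.

Lemma gen_evalC k : gen_eval iota M (mpoly.mpolyC _ k) = iota k.
Proof. exact: mpoly.mmapC. Qed.
End Eval.

Lemma gen_det_neq0 : gen_det != 0.
Proof.
apply: contra_neq (oner_neq0 K) => d0.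
by rewrite -(det1 K n) -(gen_eval_det idfun) d0 rmorph0.
Qed.

End GenericMatrix.

(* In the subring of pairs (p / delta ^ k, p(M) / (det M) ^ k), with p a      *)
(* polynomial in the entries of the generic matrix and delta its determinant, *)
(* the first component determines the second.                                 *)
Section Localization.
Variables (K : fieldType) (L : comNzRingType) (iota : {rmorphism K -> L}).
Variables (n : nat) (M N : 'M[L]_n).
Hypothesis MN : M *m N = 1%:M.

Local Notation P := (mpoly.mpoly (n * n) K).
Local Notation F := {fraction P}.
Local Notation Z := (gen_mx K n).
Local Notation delta := (gen_det K n).
Local Notation frac := (@tofrac P).

Definition loc_prop (x : F * L) : Prop := exists k p,
  x.1 * frac delta ^+ k = frac p /\ x.2 * \det M ^+ k = gen_eval iota M p.

Definition loc_pred : {pred F * L} :=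
  fun x => if excluded_middle_informative (loc_prop x) then true else false.

Lemma loc_predP x : reflect (loc_prop x) (x \in loc_pred).
Proof.
rewrite unfold_in /loc_pred.
by case: excluded_middle_informative => h; constructor.
Qed.

Lemma loc_intro p : (frac p, gen_eval iota M p) \in loc_pred.
Proof. by apply/loc_predP; exists 0%N, p; rewrite !mulr1. Qed.

Fact loc_subring_closed : subring_closed loc_pred.
Proof.
split.
- have := loc_intro 1; by rewrite !rmorph1.
- move=> [a a'] [b b'] /loc_predP[k [p [/= p1 p2]]] /loc_predP[l [q [/= q1 q2]]].
  apply/loc_predP; exists (k + l)%N, (p * delta ^+ l - q * delta ^+ k).
  rewrite !rmorphB !rmorphM !rmorphXn /= gen_eval_det -p1 -p2 -q1 -q2 !exprD.
  by split; ring.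
- move=> [a a'] [b b'] /loc_predP[k [p [/= p1 p2]]] /loc_predP[l [q [/= q1 q2]]].
  apply/loc_predP; exists (k + l)%N, (p * q).
  by rewrite !rmorphM /= -p1 -p2 -q1 -q2 !exprD; split; ring.
Qed.
HB.instance Definition _ :=
  GRing.isSubringClosed.Build (F * L)%type loc_pred loc_subring_closed.

(** When M is invertible this is K[z_ij][1/delta]: the first projection is its inclusion into the
    field of fractions, the second its specialization at M. *)
Record loc := Loc { loc_val : F * L; loc_valP : loc_val \in loc_pred }.
HB.instance Definition _ := [isSub for loc_val].
HB.instance Definition _ := [Choice of loc by <:].
HB.instance Definition _ := [SubChoice_isSubComNzRing of loc by <:].

Definition loc_fst (x : loc) : F := (val x).1.
Definition loc_snd (x : loc) : L := (val x).2.
HB.instance Definition _ := GRing.RMorphism.copy loc_fst (fst \o val).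
HB.instance Definition _ := GRing.RMorphism.copy loc_snd (snd \o val).

(** If the first component is 0, so is the numerator p; hence the second is killed by a power of
    [\det M], whose inverse is that power of [\det N]. *)
Lemma loc_fst_inj : injective loc_fst.
Proof.
move=> x y xy; apply/eqP; rewrite -subr_eq0; apply/eqP.
have : loc_fst (x - y) = 0 by rewrite rmorphB /= xy subrr.
case: (x - y) => -[a b] h; rewrite /loc_fst /= => a0.
apply: val_inj; rewrite /= a0; congr pair.
have /loc_predP[k [p [/= p1 p2]]] := h.
have p0 : p = 0 by apply/eqP; rewrite -tofrac_eq0 -p1 a0 mul0r.
have det1 : \det M ^+ k * \det N ^+ k = 1.
  by rewrite -exprMn -det_mulmx MN det1 expr1n.
by rewrite -[b]mulr1 -det1 mulrA p2 p0 rmorph0 mul0r.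
Qed.

Definition loc_const_fun (k : K) : loc := Loc (loc_intro (mpoly.mpolyC _ k)).

Fact loc_const_zmod : zmod_morphism loc_const_fun.
Proof.
move=> k l; apply: val_inj; rewrite /= /loc_const_fun /=.
by rewrite !rmorphB.
Qed.
Fact loc_const_monoid : monoid_morphism loc_const_fun.
Proof.
split; first by apply: val_inj; rewrite /= !rmorph1.
by move=> k l; apply: val_inj; rewrite /= !rmorphM.
Qed.
Definition loc_const : {rmorphism K -> loc} := HB.pack loc_const_fun
  (GRing.isZmodMorphism.Build K loc loc_const_fun loc_const_zmod)
  (GRing.isMonoidMorphism.Build K loc loc_const_fun loc_const_monoid).

Lemma loc_snd_const k : loc_snd (loc_const k) = iota k.
Proof. exact: gen_evalC. Qed.

Definition loc_mx : 'M[loc]_n := \matrix_(i, j) Loc (loc_intro (Z i j)).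

Lemma map_loc_fst : map_mx loc_fst loc_mx = map_mx frac Z.
Proof. by apply/matrixP => i j; rewrite !mxE. Qed.
Lemma map_loc_snd : map_mx loc_snd loc_mx = M.
Proof.
by rewrite -[RHS](map_gen_eval iota); apply/matrixP => i j; rewrite !mxE.
Qed.

Lemma gen_mx_unit : map_mx frac Z \in unitmx.
Proof. by rewrite unitmxE det_map_mx unitfE tofrac_eq0 gen_det_neq0. Qed.

(** Cramer's rule in both components: the common numerator is an entry of the generic adjugate, over
    the first power of the determinant. *)
Fact loc_inv_subproof i j : (invmx (map_mx frac Z) i j, N i j) \in loc_pred.
Proof.
apply/loc_predP; exists 1%N, (\adj Z i j); rewrite !expr1 /=; split.
  rewrite /invmx gen_mx_unit mxE det_map_mx -map_mx_adj mxE.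
  by rewrite mulrAC mulVf ?mul1r // tofrac_eq0 gen_det_neq0.
have -> : gen_eval iota M (\adj Z i j) = (\adj M) i j.
  by rewrite -[in RHS](map_gen_eval iota M) -map_mx_adj [RHS]mxE.
rewrite -[\adj M]mulmx1 -MN mulmxA mul_adj_mx mul_scalar_mx mxE.
by rewrite mulrC.
Qed.

Definition loc_inv_mx : 'M[loc]_n := \matrix_(i, j) Loc (loc_inv_subproof i j).

Lemma loc_mx_inv : loc_mx *m loc_inv_mx = 1%:M.
Proof.
(* By injectivity of [loc_fst], it suffices to check the identity in the field of fractions. *)
have e : map_mx loc_fst (loc_mx *m loc_inv_mx) = map_mx loc_fst 1%:M.
  rewrite map_mxM map_mx1 map_loc_fst -[RHS](mulmxV gen_mx_unit).
  by congr (_ *m _); apply/matrixP => i j; rewrite !mxE.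
apply/matrixP => i j; apply: loc_fst_inj.
by have /matrixP/(_ i j) := e; rewrite !(mxE map_mx_key).
Qed.

Lemma loc_inv_mxK : loc_inv_mx *m loc_mx = 1%:M.
Proof. exact: mulmx1C loc_mx_inv. Qed.

End Localization.

(** * Uniqueness *)

Section UnderlineConst.
Variables (K : fieldType) (G : zmodType) (lam : G -> G -> K).
Variables (sig : multiplier lam) (A : glAlg lam).

Definition underline_const_fun (k : K) : underline A sig :=
  k *: (1 : underline A sig).

Fact underline_const_zmod : zmod_morphism underline_const_fun.
Proof. by move=> k l; apply: scalerBl. Qed.

Fact underline_const_monoid : monoid_morphism underline_const_fun.
Proof.
split=> [|k l]; first exact: scale1r.
by rewrite /underline_const_fun -underline_scalerAl mul1r scalerA.
Qed.

Definition underline_const : {rmorphism K -> underline A sig} :=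
  HB.pack underline_const_fun
    (GRing.isZmodMorphism.Build _ _ underline_const_fun underline_const_zmod)
    (GRing.isMonoidMorphism.Build _ _ underline_const_fun underline_const_monoid).
End UnderlineConst.

Section Uniqueness.
Variables (K : fieldType) (G : zmodType) (lam : G -> G -> K).
Variables (sig : multiplier lam) (n : nat) (nu : 'I_n -> G).
Hypothesis K2 : 2%:R != 0 :> K.
Hypothesis n_gt0 : (0 < n)%N.
Variable D : forall A : glAlg lam, GL0 nu A -> units0 A.
Hypothesis D_nat : natural_group_morphism nu D.
Hypothesis D_diag : forall (A : glAlg lam) (a : units0 A),
  D (diag_last nu a) = a.

Section Restriction.
Variables (L : comNzRingType) (iota : {rmorphism K -> L}).

(** D read on GL_n(L) through the lift. Its value has degree 0, hence lies in L e_0, and [coef0]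
    loses no information. *)
Definition restr M N (MN : inverses M N) : L :=
  coef0 (uval (D (lift_GL0 sig iota nu MN))).

Lemma restr_eq M N (MN : inverses M N) M' N' (MN' : inverses M' N') :
  M = M' -> restr MN = restr MN'.
Proof.
move=> MM'; congr (coef0 (uval (D _))); apply: uval_inj => /=.
by rewrite MM'.
Qed.

Lemma restrM M N (MN : inverses M N) M' N' (MN' : inverses M' N')
    N'' (MN'' : inverses (M *m M') N'') :
  restr MN'' = restr MN * restr MN'.
Proof.
rewrite /restr; have -> : lift_GL0 sig iota nu MN''
    = (lift_GL0 sig iota nu MN * lift_GL0 sig iota nu MN')%g.
  by apply: uval_inj; rewrite /= lift_mxM.
rewrite D_nat.1 uvalM.
have /twist_elt_homP[a ->] := uval_in (D (lift_GL0 sig iota nu MN)).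
have /twist_elt_homP[b ->] := uval_in (D (lift_GL0 sig iota nu MN')).
rewrite twist_eltM (biadditive0l (mult_biadditive sig)) invr1 rmorph1 mul1r addr0.
by rewrite !coef0K.
Qed.

End Restriction.

Lemma restr_map (L L' : comNzRingType) (iota : {rmorphism K -> L})
    (iota' : {rmorphism K -> L'}) (phi : {rmorphism L -> L'}) M N
    (MN : inverses M N) M' N' (MN' : inverses M' N') :
  (forall k, phi (iota k) = iota' k) -> map_mx phi M = M' ->
  phi (restr iota MN) = restr iota' MN'.
Proof.
move=> phi_iota MM'; rewrite /restr.
rewrite -(@lift_map _ _ _ sig _ _ _ _ _ phi_iota n nu _ _ MN _ _ MN' MM').
rewrite D_nat.2 -(@coef0_twist_map _ _ _ sig _ _ iota iota' phi) //.
exact: uval_in.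
Qed.

Lemma restr_field (F : fieldType) (iota : {rmorphism K -> F}) M N
  (MN : inverses M N) : restr iota MN = \det M.
Proof.
have invU (M' : 'M[F]_n) : M' \in unitmx -> inverses M' (invmx M').
  by move=> uM; rewrite /inverses mulmxV // mulVmx // eqxx.
(* [det_unique] takes a total function and tests it on invertible matrices, so 0 serves as default
   elsewhere. *)
pose phi (M' : 'M[F]_n) := if @idP (M' \in unitmx) is ReflectT h
               then restr iota (invU _ h) else 0.
have phiE M' N' (MN' : inverses M' N') : phi M' = restr iota MN'.
  rewrite /phi; case: {-}_ / idP => [h|]; first exact: restr_eq.
  case; case/andP: MN' => /eqP MN' _.
  by have := mulmx1_unit MN' => -[].
have uM : M \in unitmx by case/andP: MN => /eqP /mulmx1_unit[].
rewrite -(phiE _ _ MN); apply: det_unique => // [|M' N' uM' uN'|a a0].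
- by rewrite -(rmorph_nat iota) fmorph_eq0.
- have uMN : M' *m N' \in unitmx by rewrite unitmx_mul uM' uN'.
  rewrite (phiE _ _ (invU _ uM')) (phiE _ _ (invU _ uN')).
  by rewrite (phiE _ _ (invU _ uMN)) (restrM iota (invU _ uM') (invU _ uN')).
pose E b : 'M[F]_n := diag_mx (\row_(i < n) if i.+1 == n then b else 1).
have EE b c : b * c = 1 -> E b *m E c = 1%:M.
  move=> bc; apply/matrixP => i j; rewrite mul_diag_mx !mxE.
  case: (i =P j) => [->|_]; last by rewrite mulr0n mulr0.
  by rewrite mulr1n; case: ifP => _; rewrite ?bc ?mulr1.
have Ea : inverses (E a) (E a^-1).
  by rewrite /inverses !EE ?eqxx // (mulfV, mulVf).
have TT b c : b * c = 1 -> twist_elt sig iota 0 b * twist_elt sig iota 0 c = 1.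
  move=> bc; rewrite twist_eltM (biadditive0l (mult_biadditive sig)) invr1 rmorph1.
  by rewrite bc mulr1 addr0.
(* The unit a e_0, whose diagonal matrix is the lift of [E a], brings in the normalization
   [D_diag]. *)
have ua : [&& twist_elt sig iota 0 a \in homZ0 (twist_alg sig iota),
    twist_elt sig iota 0 a^-1 \in homZ0 (twist_alg sig iota),
    twist_elt sig iota 0 a * twist_elt sig iota 0 a^-1 == 1 &
    twist_elt sig iota 0 a^-1 * twist_elt sig iota 0 a == 1].
  by rewrite !TT ?(mulfV a0, mulVf a0) // !eqxx !twist_elt_hom.
rewrite (phiE _ _ Ea) /restr (_ : lift_GL0 _ _ _ _ = diag_last nu (UnitsIn ua)).
  by rewrite D_diag /= coef0K.
by apply: uval_inj => /=; rewrite lift_diag_last_mx.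
Qed.

(** Naturality along the injective [loc_fst] settles the generic matrix by the field case;
    naturality along [loc_snd] then specializes it to M. *)
Lemma restr_det (L : comNzRingType) (iota : {rmorphism K -> L}) M N
  (MN : inverses M N) : restr iota MN = \det M.
Proof.
have /andP[/eqP MN1 _] := MN.
pose c : {rmorphism K -> loc iota M} := loc_const iota M.
have locMN : inverses (loc_mx iota M) (loc_inv_mx iota MN1).
  by rewrite /inverses loc_mx_inv loc_inv_mxK !eqxx.
have fracMN : inverses (map_mx (@tofrac _) (gen_mx K n))
    (invmx (map_mx (@tofrac _) (gen_mx K n))).
  by rewrite /inverses mulmxV ?mulVmx ?gen_mx_unit // !eqxx.
have restr_loc : restr c locMN = \det (loc_mx iota M).
  apply: (loc_fst_inj MN1).
  rewrite (@restr_map _ _ c (@tofrac _ \o @mpolyC _ _) _ _ _ locMN _ _ fracMN) //.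
    by rewrite restr_field -det_map_mx map_loc_fst.
  exact: map_loc_fst.
rewrite -(@restr_map _ _ c iota (@loc_snd _ _ _ _ _) _ _ locMN _ _ MN).
- by rewrite restr_loc -det_map_mx map_loc_snd.
- exact: loc_snd_const.
- exact: map_loc_snd.
Qed.

Lemma unique_gdet (A : glAlg lam) (X : GL0 nu A) : D X = gdet sig X.
Proof.
(* Twisted group algebras have nonzero coefficient rings here, so the zero algebra, where all
   elements agree, is treated apart. *)
apply: uval_inj => /=; have [A0|A1] := eqVneq (1 : A) 0.
  by rewrite -[LHS]mul1r -[RHS](mul1r (_ : A)) A0 !mul0r.
(* The coefficient ring is A itself with the star product, and [u] is the identity. *)
pose L : comNzRingType := HB.pack_for comNzRingType (underline A sig)
  (GRing.PzSemiRing_isNonZero.Build (underline A sig) A1).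
pose iota : {rmorphism K -> L} := @underline_const _ _ _ sig A.
pose u : {rmorphism underline A sig -> L} := @idfun (underline A sig).
have uZ k (a : underline A sig) : u (k *: a) = iota k * u a.
  rewrite [RHS](_ : _ = k *: (1 : underline A sig) * a) //.
  by rewrite -underline_scalerAl mul1r.
have JXV : inverses (J nu sig (uval X) : 'M[L]_n) (J nu sig (uinv X)).
  have [hX hX'] := (uval_in X, uinv_in X).
  apply/andP; split; apply/eqP.
    by rewrite -[LHS](JM sig hX hX') uvalV J1.
  by rewrite -[LHS](JM sig hX' hX) uinvV J1.
have Xmap : map_mx u (J nu sig (uval X)) = J nu sig (uval X).
  by apply/matrixP => i j; rewrite !mxE.
have hD := uval_in (D X).
have := restr_det iota JXV; rewrite /restr.
(* By naturality along the coaction, the left side is the e_0 coefficient of the image of [D X];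
   since [D X] has degree 0, this is [D X] itself. *)
rewrite -(@coaction_lift _ _ _ sig A L iota u uZ n nu X _ _ JXV Xmap) D_nat.2.
by rewrite /= (@coact_hom _ _ _ sig A L iota u 0 _ hD) coef0K.
Qed.
End Uniqueness.

Theorem theorem3 (K : fieldType) (charK : [pchar K] =i pred0)
    (G : zmodType) (fgG : finitely_generated G)
    (lam : G -> G -> K) (lamP : commutation_factor lam)
    (lam_even : forall x : G, lam x x = 1)
    (n : nat) (n_ge1 : (1 <= n)%N) (nu : 'I_n -> G) :
  exists Gdet : forall A : glAlg lam, GL0 nu A -> units0 A,
    unique (fun D : forall A : glAlg lam, GL0 nu A -> units0 A =>
              natural_group_morphism nu D /\
              forall (A : glAlg lam) (a : units0 A),
                D A (diag_last nu a) = a) Gdet /\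
    forall (sig : multiplier lam) (A : glAlg lam) (X : GL0 nu A),
      uval (Gdet A X) = \det (J nu sig (uval X)) :> underline A sig.
Proof.
have K2 : 2%:R != 0 :> K by have /negbT := charK 2; rewrite inE.
have [sig] := multiplier_exists lamP lam_even fgG.
have gdetP (s : multiplier lam) := conj (gdet_natural s nu)
  (fun A a => gdet_diag_last s nu (A := A) a n_ge1).
exists (fun A X => gdet sig X); split; first split.
- exact: gdetP.
- move=> D [D_nat D_diag].
  apply: functional_extensionality_dep => A.
  apply: functional_extensionality => X.
  by rewrite (unique_gdet sig K2 n_ge1 D_nat D_diag).
(* The map built from [sig] satisfies both axioms, so uniqueness carried out with [s] identifies it
   with the determinant for [s]. *)
move=> s A X; have [g_nat g_diag] := gdetP sig.
by rewrite (unique_gdet s K2 n_ge1 g_nat g_diag).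
Qed.
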